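(* Consider the over-the-air average consensus protocol described in the context, with step sizes $\alpha(k)>0$ satisfying (i) $\sum_{k=0}^\infty \alpha(k)=\infty$ and $\sum_{k=0}^\infty \alpha^2(k)<\infty$, and (ii) $1-\alpha(k)\sum_{j\in\mathcal{V}}\bar a_{ij}>0$ for all $i\in\mathcal{V}$, $k\ge 0$. Then the system achieves almost sure consensus: there exists a random variable $x^*$ such that $\lim_{k\to\infty}x_i(k)=x^*$ almost surely for every $i\in\mathcal{V}$.
   Context: Agents $\mathcal{V}=\{1,\dots,N\}$ communicate over a connected undirected graph $\mathcal{G}=(\mathcal{V},\mathcal{E})$ without self-loops; $\widetilde{\mathcal{N}}_i=\{j:(i,j)\in\mathcal{E}\}$. Each agent has a deterministic initial state $x_i(0)\in[0,x_{\max}]$. Fix $\rho>0$ and $u\in\mathbb{C}$ with $|u|=1$. The following random variables are all mutually independent: for each $i$ and $k\ge0$, $\gamma_i(k)\in\{0,1\}$ with $\mathbb{P}(\gamma_i(k)=1)=p_i\in(0,1)$; for each ordered pair $(i,j)$ and $k\ge0$, $h_{ij}(k)\sim\mathcal{CN}(0,\Lambda_{ij})$ with $\Lambda_{ij}=\Lambda_{ji}>0$; for each $i$ and $k\ge0$, $n_i(k)\sim\mathcal{CN}(0,\sigma_i^2)$. Let $\Gamma_{ij}(k)=\gamma_i(k)(1-\gamma_j(k))+\gamma_j(k)(1-\gamma_i(k))$. Agent $i$ receives $y_i(k)=\sum_{j\in\widetilde{\mathcal{N}}_i}\Gamma_{ij}(k)h_{ij}(k)\sqrt{\rho x_j(k)}\,u+n_i(k)$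 (the model treats the states as nonnegative so that the square root is real). Define $\bar a_{ij}=\rho\big(p_i(1-p_j)+p_j(1-p_i)\big)\Lambda_{ij}$ for $j\in\widetilde{\mathcal{N}}_i$ and $\bar a_{ij}=0$ otherwise. The protocol is $$x_i(k+1)=\Big(1-\alpha(k)\sum_{j\in\mathcal{V}}\bar a_{ij}\Big)x_i(k)+\alpha(k)\big(|y_i(k)|^2-\sigma_i^2\big).$$ *)

(* Defs.v *)
From HB Require Import structures.
From mathcomp Require Import all_boot all_order all_algebra.
From mathcomp Require Import all_classical all_reals all_analysis.
Set Implicit Arguments. Unset Strict Implicit. Unset Printing Implicit Defensive.
Import Order.TTheory GRing.Theory Num.Theory numFieldNormedType.Exports.
Local Open Scope classical_set_scope.
Local Open Scope ring_scope.

Definition mutually_independent d (T : measurableType d) (R : realType)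
    (P : probability T R) (I : eqType) (X : I -> T -> R) : Prop :=
  forall (S : seq I), uniq S ->
  forall B : I -> set R, (forall i, measurable (B i)) ->
  P (\bigcap_(i in [set` S]) (X i @^-1` B i)) = (\prod_(i <- S) P (X i @^-1` B i))%E.

Definition centered_gaussian d (T : measurableType d) (R : realType)
    (P : probability T R) (X : T -> R) (v : R) : Prop :=
  if v == 0 then P (X @^-1` [set 0]) = 1%E
  else forall B : set R, measurable B ->
       P (X @^-1` B) = normal_prob 0 (Num.sqrt v) B.

(* Z = Zr + i Zi ~ CN(0, v): real and imaginary parts independent (handled by the
   global independence hypothesis), each N(0, v/2). *)
Definition complex_gaussian d (T : measurableType d) (R : realType)
    (P : probability T R) (Zr Zi : T -> R) (v : R) : Prop :=
  centered_gaussian P Zr (v / 2) /\ centered_gaussian P Zi (v / 2).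

(* Labels of all the elementary real random variables of the model. *)
Definition lab (N : nat) : eqType :=
  (('I_N * nat) +                     (* gamma_i(k) *)
   (('I_N * 'I_N * nat) +             (* Re h_ij(k) *)
    (('I_N * 'I_N * nat) +            (* Im h_ij(k) *)
     (('I_N * nat) +                  (* Re n_i(k) *)
      ('I_N * nat)))))%type.          (* Im n_i(k) *)

Definition model_family d (T : measurableType d) (R : realType) (N : nat)
    (gam : 'I_N -> nat -> T -> R)
    (hr hi : 'I_N -> 'I_N -> nat -> T -> R)
    (nr ni : 'I_N -> nat -> T -> R) : lab N -> T -> R :=
  fun l => match l with
  | inl (i, k) => gam i k
  | inr (inl (i, j, k)) => hr i j k
  | inr (inr (inl (i, j, k))) => hi i j k
  | inr (inr (inr (inl (i, k)))) => nr i k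
  | inr (inr (inr (inr (i, k)))) => ni i k
  end.

Definition simple_connected_graph (N : nat) (e : rel 'I_N) : Prop :=
  symmetric e /\ irreflexive e /\ (forall i j, connect e i j).

Definition abar (R : realType) (N : nat) (e : rel 'I_N) (rho : R)
    (p : 'I_N -> R) (Lam : 'I_N -> 'I_N -> R) (i j : 'I_N) : R :=
  if e i j then rho * (p i * (1 - p j) + p j * (1 - p i)) * Lam i j else 0.

Definition Gam (T : Type) (R : realType) (N : nat) (gam : 'I_N -> nat -> T -> R)
    (i j : 'I_N) (k : nat) (t : T) : R :=
  gam i k t * (1 - gam j k t) + gam j k t * (1 - gam i k t).

(* |y_i(k)|^2 where y_i(k) = sum_{j in N_i} Gamma_ij h_ij sqrt(rho x_j) u + n_i,
   complex numbers written as (real part, imaginary part); u = ur + i ui. *)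
Definition ysq (T : Type) (R : realType) (N : nat) (e : rel 'I_N) (rho ur ui : R)
    (gam : 'I_N -> nat -> T -> R) (hr hi : 'I_N -> 'I_N -> nat -> T -> R)
    (nr ni : 'I_N -> nat -> T -> R) (x : 'I_N -> T -> R)
    (k : nat) (i : 'I_N) (t : T) : R :=
  let c j := Gam gam i j k t * Num.sqrt (rho * x j t) in
  let yr := \sum_(j < N | e i j) c j * (hr i j k t * ur - hi i j k t * ui) + nr i k t in
  let yi := \sum_(j < N | e i j) c j * (hr i j k t * ui + hi i j k t * ur) + ni i k t in
  yr ^+ 2 + yi ^+ 2.

Fixpoint state (T : Type) (R : realType) (N : nat) (e : rel 'I_N)
    (rho ur ui : R) (p : 'I_N -> R) (Lam : 'I_N -> 'I_N -> R) (sig2 : 'I_N -> R)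
    (alpha : nat -> R) (x0 : 'I_N -> R)
    (gam : 'I_N -> nat -> T -> R) (hr hi : 'I_N -> 'I_N -> nat -> T -> R)
    (nr ni : 'I_N -> nat -> T -> R) (k : nat) : 'I_N -> T -> R :=
  match k with
  | 0 => fun i _ => x0 i
  | k'.+1 =>
    let x := state e rho ur ui p Lam sig2 alpha x0 gam hr hi nr ni k' in
    fun i t =>
      (1 - alpha k' * \sum_(j < N) abar e rho p Lam i j) * x i t
      + alpha k' * (ysq e rho ur ui gam hr hi nr ni x k' i t - sig2 i)
  end.

(* Main.v *)
Require Import Defs.
From HB Require Import structures.
From mathcomp Require Import all_boot all_order all_algebra.
From mathcomp Require Import all_classical all_reals all_analysis.
From mathcomp Require Import measurable_realfun ring lra.
Set Implicit Arguments. Unset Strict Implicit. Unset Printing Implicit Defensive.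
Import Order.TTheory GRing.Theory Num.Theory numFieldNormedType.Exports.
Local Open Scope classical_set_scope.
Local Open Scope ring_scope.

(* States may become negative, and the square root then reads them as 0, so the mean
   dynamics is x_i <- x_i - alpha sum_j abar_ij (x_i - max(x_j, 0)).
   V = sum_i (x_i - 1)^2 decreases in mean by alpha times
     sum_ij abar_ij (x_i - max(x_j, 0))^2 + 2 sum_ij abar_ij (max(x_j, 0) - x_j)
   up to O(alpha^2 (1 + V)); hence V is bounded in mean and both sums, weighted by
   alpha, are summable over time almost surely. The noise has bounded second moments,
   so its alpha-weighted sum is an L^2-bounded martingale and converges almost surely.
   The rest is deterministic. If q = sum_ij abar_ij |x_i - max(x_j, 0)| kept climbing
   from e to 3 e, it would spend there an alpha-weighted time bounded below, because x
   moves at speed at most q apart from the convergent noise; this contradicts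
   sum alpha q^2 < oo. So q -> 0 and neighbours, hence all agents, agree asymptotically,
   while sum_i x_i is a convergent noise sum plus a convergent series of nonnegative
   terms. *)

(** * Expectation and independence *)

(** Means given the past are handled through test functions. Every elementary variable has a label,
    a function is tagged with a set of labels that determine it, and a label outside this set
    factors out of expectations; an identity valid after multiplication by every admissible [F] of
    the past stands for a conditional expectation. A time step is revealed in two stages: once the
    switches of time k are known, y_i(k) is a linear form in fresh Gaussian variables. Its second
    moment must be exact, since it gives the drift; for its fourth moment a crude bound is enough,
    since it enters only with the factor alpha^2. The centre 1 in V matters. With centre 0 the
    negative parts of the states would enter the dissipation only through their squares. A positive
    centre adds a term linear in them, and this linear term is precisely the drift of sum_i x_i. *)

Section Expectation.
Context d (T : measurableType d) (R : realType) (P : {measure set T -> \bar R}).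
Implicit Types f g : T -> R.

Definition intg f := P.-integrable setT (EFin \o f).
Definition ex f : R := (\int[P]_t f t)%R.

Lemma intg_measurable f : intg f -> measurable_fun setT f.
Proof. by move=> /integrableP[/measurable_EFinP]. Qed.

Lemma intg_dom f g : measurable_fun setT f -> intg g ->
  (forall t, `|f t| <= g t) -> intg f.
Proof.
move=> mf ig fg; apply: (le_integrable measurableT _ _ ig).
  exact/measurable_EFinP.
move=> t _ /=; rewrite lee_fin (le_trans (fg t))//.
by rewrite real_ler_norm// num_real.
Qed.

Lemma eq_intg f g : f =1 g -> intg f -> intg g.
Proof. by move=> /funext ->. Qed.

Lemma eq_ex f g : f =1 g -> ex f = ex g.
Proof. by move=> /funext ->. Qed.

Lemma intgD f g : intg f -> intg g -> intg (fun t => f t + g t).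
Proof. by move=> i j; have := integrableD measurableT i j; exact: eq_integrable. Qed.

Lemma intgZ (c : R) f : intg f -> intg (fun t => c * f t).
Proof. by move=> i; have := integrableZl measurableT c i; exact: eq_integrable. Qed.

Lemma intgN f : intg f -> intg (fun t => - f t).
Proof. by move=> /(intgZ (-1)); apply: eq_intg => t; rewrite mulN1r. Qed.

Lemma intgB f g : intg f -> intg g -> intg (fun t => f t - g t).
Proof. by move=> i /intgN; exact: intgD. Qed.

Lemma intg_sum (J : Type) (s : seq J) (p : pred J) (F : J -> T -> R) :
  (forall j, p j -> intg (F j)) -> intg (fun t => \sum_(j <- s | p j) F j t).
Proof.
move=> iF; elim: s => [|j s IH].
  by apply: eq_intg (@integrable0 _ _ _ P setT) => t; rewrite big_nil.
case: (boolP (p j)) => pj.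
  by apply: eq_intg (intgD (iF _ pj) IH) => t; rewrite big_cons pj.
by apply: eq_intg IH => t; rewrite big_cons (negbTE pj).
Qed.

Lemma intg_norm f : intg f -> intg (fun t => `|f t|).
Proof. exact: integrable_norm. Qed.

Lemma exD f g : intg f -> intg g -> ex (fun t => f t + g t) = ex f + ex g.
Proof. exact: RintegralD. Qed.

Lemma exB f g : intg f -> intg g -> ex (fun t => f t - g t) = ex f - ex g.
Proof. exact: RintegralB. Qed.

Lemma exZ (c : R) f : intg f -> ex (fun t => c * f t) = c * ex f.
Proof. exact: RintegralZl. Qed.

Lemma ex_sum (J : Type) (s : seq J) (p : pred J) (F : J -> T -> R) :
  (forall j, p j -> intg (F j)) ->
  ex (fun t => \sum_(j <- s | p j) F j t) = \sum_(j <- s | p j) ex (F j).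
Proof.
move=> iF; elim: s => [|j s IH].
  rewrite big_nil -[RHS](mul0r (fine (P setT))) -Rintegral_cst//.
  by apply: eq_ex => t; rewrite big_nil.
rewrite big_cons; case: (boolP (p j)) => pj; rewrite -IH.
  rewrite -exD; [|exact: iF|exact: intg_sum].
  by apply: eq_ex => t; rewrite big_cons pj.
by apply: eq_ex => t; rewrite big_cons (negbTE pj).
Qed.

Lemma ex_le f g : intg f -> intg g -> (forall t, f t <= g t) -> ex f <= ex g.
Proof. by move=> i j fg; exact: le_Rintegral. Qed.

Lemma ex_ge0 f : (forall t, 0 <= f t) -> 0 <= ex f.
Proof. by move=> f0; exact: Rintegral_ge0. Qed.

Lemma EFin_ex f : intg f -> (ex f)%:E = (\int[P]_t (f t)%:E)%E.
Proof. by move=> i; rewrite /ex /Rintegral fineK//; exact: integrable_fin_num. Qed.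

Lemma intg_mul_sqr f g : measurable_fun setT f -> measurable_fun setT g ->
  intg (fun t => f t ^+ 2) -> intg (fun t => g t ^+ 2) ->
  intg (fun t => f t * g t).
Proof.
move=> mf mg i j; apply: (intg_dom _ (intgD i j)); first exact: measurable_funM.
move=> t; rewrite normrM -[f t ^+ 2]real_normK ?num_real//.
rewrite -[g t ^+ 2]real_normK ?num_real//.
have := sqr_ge0 (`|f t| - `|g t|); have := normr_ge0 (f t).
have := normr_ge0 (g t); nra.
Qed.

End Expectation.

Section ProbabilityExpectation.
Context d (T : measurableType d) (R : realType) (P : probability T R).
Implicit Types f g : T -> R.

Lemma intg_cst (c : R) : intg P (fun=> c).
Proof. exact: finite_measure_integrable_cst. Qed.

Lemma ex_cst (c : R) : ex P (fun=> c) = c.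
Proof. by rewrite /ex /Rintegral; have := expectation_cst P c; rewrite unlock => ->. Qed.

Lemma intg_sqr f : measurable_fun setT f -> intg P (fun t => f t ^+ 2) ->
  intg P f.
Proof.
move=> mf i; have i1 : intg P (fun=> 1 ^+ 2) by exact: intg_cst.
by apply: eq_intg (intg_mul_sqr mf (measurable_cst _) i i1) => t; rewrite mulr1.
Qed.

Lemma markov_ex f (a : R) : 0 < a -> intg P f -> (forall t, 0 <= f t) ->
  (P [set t | (a <= f t)%R] <= (ex P f / a)%:E)%E.
Proof.
move=> a0 i f0; have mf := intg_measurable i.
rewrite EFinM muleC -lee_pdivrMl ?invr_gt0// invrK EFin_ex//.
have := @le_integral_comp_abse _ T R P setT measurableT (EFin \o f) a id
  (@measurable_id _ _ _) (fun _ => id) (fun _ _ _ _ => id) _ a0.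
rewrite setTI; under eq_integral do rewrite /= ger0_norm//.
suff -> : [set x | (a%:E <= `|(EFin \o f) x|)%E] = [set t | (a <= f t)%R].
  by apply; exact/measurable_EFinP.
by apply/seteqP; split => t; rewrite /= lee_fin ger0_norm.
Qed.

Lemma chebyshev_sqr f (a : R) : 0 < a -> intg P (fun t => f t ^+ 2) ->
  (P [set t | (a <= `|f t|)%R] <= (ex P (fun t => f t ^+ 2) / a ^+ 2)%:E)%E.
Proof.
move=> a0 i.
have -> : [set t | (a <= `|f t|)%R] = [set t | (a ^+ 2 <= f t ^+ 2)%R].
  by apply/seteqP; split => t /=; rewrite -[f t ^+ 2]real_normK ?num_real//
     ler_sqr ?nnegrE// ltW.
by apply: markov_ex => // [|t]; [exact: exprn_gt0|exact: sqr_ge0].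
Qed.

End ProbabilityExpectation.

(** * Product rule for a fresh label *)

Section Independence.
Context d (T : measurableType d) (R : realType) (P : probability T R).
Context (I : eqType) (X : I -> T -> R).
Hypothesis mX : forall i, measurable_fun setT (X i).
Hypothesis indX : mutually_independent P X.

(* The pi-system generating the sigma-algebra of [(X i)_(i in L)]; [dep L f] says
   that [f] is measurable for that sigma-algebra. *)
Definition cyl (L : set I) : set_system T :=
  [set A | exists S : seq I, uniq S /\ [set` S] `<=` L /\
     exists2 B : I -> set R, (forall i, measurable (B i)) &
       A = \bigcap_(i in [set` S]) (X i @^-1` B i)].

Definition dep (L : set I) (f : T -> R) :=
  @measurable_fun _ _ (g_sigma_algebraType (cyl L)) R setT f.

Lemma measurable_X_preimage i (B : set R) : measurable B ->
  measurable (X i @^-1` B).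
Proof. by move=> mB; rewrite -[X in measurable X]setTI; exact: mX. Qed.

Lemma cyl_measurable L A : cyl L A -> measurable A.
Proof.
move=> [S [_ [_ [B mB ->]]]]; elim: S => [|i S IH].
  rewrite [X in measurable X](_ : _ = setT)//.
  by apply/seteqP; split => // t _ i.
rewrite [X in measurable X](_ : _ = X i @^-1` B i `&`
    \bigcap_(j in [set` S]) X j @^-1` B j).
  by apply: measurableI => //; exact: measurable_X_preimage.
apply/seteqP; split => [t h|t [h1 h2] j /=].
  split; first by apply: (h i); rewrite /= inE eqxx.
  by move=> j jS; apply: h; rewrite /= inE jS orbT.
by rewrite inE => /orP[/eqP ->|/h2].
Qed.

Lemma cylI L : setI_closed (cyl L).
Proof.
move=> A1 A2 [S1 [u1 [l1 [B1 m1 ->]]]] [S2 [u2 [l2 [B2 m2 ->]]]].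
exists (undup (S1 ++ S2)); split; first exact: undup_uniq.
split.
  move=> i; rewrite /= mem_undup mem_cat => /orP[] h; [exact: l1|exact: l2].
exists (fun i => (if i \in S1 then B1 i else setT) `&`
                 (if i \in S2 then B2 i else setT)).
  by move=> i; apply: measurableI; case: ifP.
apply/seteqP; split => [t [h1 h2] i /= |t h].
  rewrite mem_undup mem_cat => _; split; case: ifP => // iS; [exact: h1|exact: h2].
split => i /= iS; have /= := h i; rewrite mem_undup mem_cat iS ?orbT => /(_ erefl).
  by case.
by case.
Qed.

Lemma sub_cyl L1 L2 : L1 `<=` L2 -> cyl L1 `<=` cyl L2.
Proof. by move=> L12 A [S [u [l h]]]; exists S; split=> //; split => // i /l /L12. Qed.

Lemma sig_measurable L A : <<s cyl L >> A -> measurable A.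
Proof.
apply: (@smallest_sub _ (sigma_algebra setT)) => //.
  exact: sigma_algebra_measurable.
exact: cyl_measurable.
Qed.

Lemma dep_measurable L f : dep L f -> measurable_fun setT f.
Proof. by move=> df _ B mB; apply: (sig_measurable (L := L)); exact: df. Qed.

Lemma sub_dep L1 L2 f : L1 `<=` L2 -> dep L1 f -> dep L2 f.
Proof.
move=> L12 df _ B mB; have := df measurableT B mB.
exact: (sub_sigma_algebra2 (D := setT) (sub_cyl L12)).
Qed.

Lemma dep_X (L : set I) i : L i -> dep L (X i).
Proof.
move=> Li _ B mB; rewrite setTI; apply: sub_sigma_algebra.
exists [:: i]; split => //; split.
  by move=> j /=; rewrite inE => /eqP ->.
exists (fun=> B) => //; apply/seteqP; split => [t Bt j /=|t h].
  by rewrite inE => /eqP ->.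
by apply: (h i); rewrite /= inE.
Qed.

Lemma cyl_indep L l A B : ~ L l -> cyl L A -> measurable B ->
  P (A `&` X l @^-1` B) = (P A * P (X l @^-1` B))%E.
Proof.
move=> Ll [S [u [SL [C mC ->]]]] mB.
have lS : l \notin S by apply/negP => /SL.
(* As [l] is not in [S], overriding [C] at [l] leaves the cylinder unchanged, and one family of sets
   serves both [S] and [l :: S]. *)
pose D i := if i == l then B else C i.
have mD i : measurable (D i) by rewrite /D; case: ifP.
have -> : \bigcap_(i in [set` S]) X i @^-1` C i =
          \bigcap_(i in [set` S]) X i @^-1` D i.
  apply: eq_bigcapr => i iS; rewrite /D; case: eqP => // il.
  by move: lS; rewrite -il iS.
rewrite (indX u mD).
have -> : X l @^-1` B = X l @^-1` D l by rewrite /D eqxx.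
have := indX (S := l :: S); rewrite /= lS u => /(_ erefl _ mD).
rewrite big_cons muleC => <-; congr (P _).
apply/seteqP; split => [t [h1 h2] i /=|t h].
  by rewrite inE => /orP[/eqP ->|/h1].
split; first by move=> i iS; apply: h => /=; rewrite inE iS orbT.
by apply: (h l); rewrite /= inE eqxx.
Qed.

Lemma sig_indep L l A B : ~ L l -> <<s cyl L >> A -> measurable B ->
  P (A `&` X l @^-1` B) = (P A * P (X l @^-1` B))%E.
Proof.
move=> Ll sA mB; have mXB := measurable_X_preimage l mB.
have fP : P (X l @^-1` B) \is a fin_num by exact: fin_num_measure.
have r0 : 0 <= fine (P (X l @^-1` B)) by exact: fine_ge0.
pose r : {nonneg R} := NngNum r0.
have cT : cyl L setT.
  exists [::]; split => //; split => //; exists (fun=> setT) => //.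
  by apply/seteqP; split.
have E (C : set T) : (mscale r P C = P C * P (X l @^-1` B))%E.
  by rewrite /mscale /= fineK// muleC.
rewrite -E; change (mrestr P mXB A = mscale r P A).
apply: (@g_sigma_algebra_measure_unique _ R T (cyl L) (@cyl_measurable L)
  (fun=> setT) (fun=> cT) _ _ _ (@cylI L) _ _ _ sA).
- by rewrite bigcup_const.
- move=> C cC; apply: etrans (esym (E C)).
 exact: (cyl_indep Ll cC mB).
- by move=> _; change (P (setT `&` X l @^-1` B) < +oo)%E; rewrite setTI ltey_eq fP.
Qed.

(** By [sig_indep] the joint law of [f] and [X l] factors on rectangles, so it is the product of the
    two laws; Fubini applied to [z.1 * g z.2] gives both integrability and the product formula. *)
Lemma indep_mul L l (f : T -> R) (g : R -> R) : ~ L l -> dep L f ->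
  measurable_fun setT g -> intg P f -> intg P (g \o X l) ->
  intg P (fun t => f t * g (X l t)) /\
  ex P (fun t => f t * g (X l t)) = ex P f * ex P (g \o X l).
Proof.
move=> Ll df mg if_ ig; have mf := dep_measurable df.
pose fm : {mfun T >-> R} := HB.pack f (isMeasurableFun.Build _ _ _ _ f mf).
pose xm : {mfun T >-> R} :=
  HB.pack (X l) (isMeasurableFun.Build _ _ _ _ (X l) (mX l)).
pose phi t := (f t, X l t).
have mphi : measurable_fun setT phi by exact: measurable_fun_pair.
pose m1 := distribution P fm; pose m2 := distribution P xm.
pose h (z : R * R) := (z.1 * g z.2)%:E.
have mh : measurable_fun setT h.
  apply/measurable_EFinP/measurable_funM; first exact: measurable_fst.
  by apply: (measurableT_comp mg); exact: measurable_snd.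
have joint (A : set (R * R)) : measurable A ->
    (m1 \x m2)%E A = pushforward P phi A.
  apply: product_measure_unique => A1 A2 mA1 mA2.
  rewrite /= /pushforward /m1 /m2 /distribution /pushforward /=.
  rewrite -(sig_indep Ll _ mA2)//.
  by have := df measurableT A1 mA1; rewrite setTI.
have int1 : (\int[m1]_a `|a%:E| < +oo)%E.
  rewrite ge0_integral_distribution//; last exact: measurableT_comp.
  by have /integrableP[] := if_.
have int2 : (\int[m2]_b `|(g b)%:E| < +oo)%E.
  rewrite ge0_integral_distribution//; last first.
    by apply: measurableT_comp => //; exact/measurable_EFinP.
  by have /integrableP[] := ig.
have mg1 : measurable_fun setT (EFin \o g) by exact/measurable_EFinP.
have ih : (m1 \x m2)%E.-integrable setT h.
  apply/integrable12ltyP => //.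
  rewrite [ltLHS](_ : _ = ((\int[m1]_a `|a%:E|) * (\int[m2]_b `|(g b)%:E|))%E).
    by rewrite lte_mul_pinfty// ?integral_ge0// ge0_fin_numE ?integral_ge0.
  rewrite -ge0_integralZr//; [|exact: measurableT_comp|exact: integral_ge0].
  apply: eq_integral => a _; rewrite -ge0_integralZl//; last exact: measurableT_comp.
  by apply: eq_integral => b _; rewrite /h EFinM abseM.
have meq (F : R * R -> \bar R) :
    (\int[m1 \x m2]_z F z = \int[pushforward P phi]_z F z)%E.
  by apply: eq_measure_integral => A mA _; exact: joint.
have ifg : intg P (fun t => f t * g (X l t)).
  apply/integrableP; split.
    apply/measurable_EFinP/measurable_funM => //.
    exact: measurableT_comp.
  have /integrableP[_] := ih; rewrite meq ge0_integral_pushforward//.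
  exact: measurableT_comp.
split => //; apply: EFin_inj; rewrite EFinM !EFin_ex//.
transitivity (\int[pushforward P phi]_z h z)%E.
  by rewrite integral_pushforward.
rewrite -meq -(integral12_prod_meas1 ih).
have -> : (\int[P]_t (f t)%:E = \int[m1]_a a%:E)%E.
  by rewrite integral_distribution.
have -> : (\int[P]_t ((g \o X l) t)%:E = \int[m2]_b (g b)%:E)%E.
  by rewrite integral_distribution.
have i1 : m1.-integrable setT EFin.
  by apply/integrableP; split => //; exact/measurable_EFinP.
have i2 : m2.-integrable setT (EFin \o g) by apply/integrableP; split.
have fi2 : (\int[m2]_b (g b)%:E)%E \is a fin_num by exact: integrable_fin_num.
rewrite -(fineK fi2) -integralZr//; apply: eq_integral => a _.
rewrite (fineK fi2) /fubini_F -integralZl//.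
Qed.

End Independence.

(** * Moments of the normal distribution *)

Section NormalMoments.
Context (R : realType).
Local Notation mu := (@lebesgue_measure R).
Implicit Types (s m : R).

(** The Radon-Nikodym derivative of the normal law and the explicit density have the same integral
    over every measurable set, so they agree almost everywhere. *)
Lemma ge0_integral_normal_prob s (G : R -> \bar R) :
  measurable_fun setT G -> (forall x, 0 <= G x)%E ->
  (\int[normal_prob 0 s]_x G x = \int[mu]_x (G x * (normal_pdf 0 s x)%:E))%E.
Proof.
move=> mG G0.
have dom := normal_prob_dominates (0:R) s.
have mp : measurable_fun setT (fun x => (normal_pdf 0 s x)%:E).
  by apply/measurable_EFinP; exact: measurable_normal_pdf.
rewrite -(Radon_Nikodym_SigmaFinite.change_of_variables dom)//.
have fi := Radon_Nikodym_SigmaFinite.f_integrable dom.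
apply: ae_eq_integral => //.
- by apply: emeasurable_funM => //; exact: measurable_int fi.
- exact: emeasurable_funM.
- apply: ae_eqe_mul2l; apply: integral_ae_eq => //.
  by move=> A _ mA; rewrite -Radon_Nikodym_SigmaFinite.f_integral.
Qed.

Lemma normal_pdf_pos m s x : 0 < s ->
  normal_pdf m s x = normal_peak s * expR (- (x - m) ^+ 2 / (s ^+ 2 *+ 2)).
Proof. by move=> s0; rewrite normal_pdfE// gt_eqF. Qed.

Lemma normal_peak_scale s : 0 < s -> s * normal_peak s = normal_peak 1 :> R.
Proof.
move=> s0; rewrite /normal_peak expr1n mul1r -mulrnAr sqrtrM ?sqr_ge0//.
rewrite sqrtr_sqr gtr0_norm// invfM mulrA divff ?mul1r//.
by rewrite gt_eqF.
Qed.

Lemma intg_normal_pdf m s : intg mu (normal_pdf m s).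
Proof. exact: integrable_normal_pdf. Qed.

Lemma ex_normal_pdf m s : ex mu (normal_pdf m s) = 1.
Proof. by rewrite /ex /Rintegral integral_normal_pdf. Qed.

(** Doubling the standard deviation leaves room in the exponent to absorb a quartic. Integrability
    of all the polynomials needed and the fourth-moment bound [64 * s ^+ 4] both follow from this
    comparison. *)
Lemma normal_pdf_quartic s x : 0 < s ->
  x ^+ 4 * normal_pdf 0 s x <= 64 * s ^+ 4 * normal_pdf 0 (2 * s) x.
Proof.
move=> s0; have s20 : 0 < 2 * s by rewrite mulr_gt0.
rewrite !normal_pdf_pos// subr0.
have pk : normal_peak s = 2 * normal_peak (2 * s).
  apply: (mulfI (lt0r_neq0 s0)); rewrite normal_peak_scale// mulrCA.
  by rewrite -(normal_peak_scale s20); ring.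
have s1 : s != 0 by rewrite gt_eqF.
set u := x ^+ 2 / (s ^+ 2 *+ 2).
have -> : - x ^+ 2 / ((2 * s) ^+ 2 *+ 2) = - u + (3 / 4 * u) by rewrite /u; field.
have -> : - x ^+ 2 / (s ^+ 2 *+ 2) = - u by rewrite /u mulNr.
rewrite expRD pk.
have u0 : 0 <= u by rewrite divr_ge0 ?sqr_ge0// mulrn_wge0// sqr_ge0.
have -> : x ^+ 4 = 4 * s ^+ 4 * u ^+ 2 by rewrite /u; field.
(* Square [1 + 3/8 u <= expR (3/8 u)]; the coefficient [9/64] of [u^2] is at least [1/8]. *)
have h : u ^+ 2 <= 8 * expR (3 / 4 * u).
  have := @expR_ge1Dx R (3 / 8 * u).
  have e : expR (3 / 4 * u) = expR (3 / 8 * u) ^+ 2.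
    by rewrite -expRM_natl; congr expR; field.
  rewrite e; nra.
have := normal_peak_ge0 (2 * s); have := expR_ge0 (- u); have := exprn_even_ge0 s (isT : ~~ odd 4).
move=> s4 e0 p0.
have := mulr_ge0 (mulr_ge0 p0 e0) s4.
set w := normal_peak _ * _ * _ => w0.
rewrite (_ : 4 * s ^+ 4 * u ^+ 2 * _ = 8 * w * u ^+ 2); last by rewrite /w; ring.
rewrite (_ : 64 * s ^+ 4 * _ = 8 * w * (8 * expR (3 / 4 * u))); last by rewrite /w; ring.
by rewrite ler_wpM2l// mulr_ge0.
Qed.

Lemma measurable_pdfM (g : R -> R) m s : measurable_fun setT g ->
  measurable_fun setT (fun x => g x * normal_pdf m s x).
Proof. by move=> mg; apply: measurable_funM => //; exact: measurable_normal_pdf. Qed.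

Lemma intg_quartic_pdf s : 0 < s -> intg mu (fun x => x ^+ 4 * normal_pdf 0 s x).
Proof.
move=> s0; apply: intg_dom (intgZ (64 * s ^+ 4) (intg_normal_pdf 0 (2 * s))) _.
  by apply: measurable_pdfM; exact: measurable_funX.
move=> x; rewrite ger0_norm; last by rewrite mulr_ge0 ?normal_pdf_ge0 ?exprn_even_ge0.
exact: normal_pdf_quartic.
Qed.

Lemma intg_poly_pdf (g : R -> R) s : 0 < s -> measurable_fun setT g ->
  (forall x, `|g x| <= 1 + x ^+ 4) -> intg mu (fun x => g x * normal_pdf 0 s x).
Proof.
move=> s0 mg gx.
apply: intg_dom (intgD (intg_normal_pdf 0 s) (intg_quartic_pdf s0)) _.
  exact: measurable_pdfM.
move=> x; rewrite normrM (ger0_norm (normal_pdf_ge0 _ _ _)).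
by rewrite -[X in _ <= X + _]mul1r -mulrDl ler_wpM2r ?normal_pdf_ge0.
Qed.

Lemma norm_le_quartic (x : R) : `|x| <= 1 + x ^+ 4.
Proof.
have := sqr_ge0 (x - 1); have := sqr_ge0 (x + 1); have := sqr_ge0 (x ^+ 2 - 1).
by rewrite ler_norml => *; apply/andP; split; nra.
Qed.

Lemma sqr_le_quartic (x : R) : `|x ^+ 2| <= 1 + x ^+ 4.
Proof.
have := sqr_ge0 (x ^+ 2 - 1); have := sqr_ge0 (x ^+ 2).
by rewrite ger0_norm ?sqr_ge0//; nra.
Qed.

(* [expR u >= 1 + u] compares the densities of mean [m] and [0]; integrating gives
   [m * E <= m^2 / 2] for the first moment [E], and one takes [m = E]. *)
Lemma ex_id_pdf s : 0 < s -> ex mu (fun x => x * normal_pdf 0 s x) = 0.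
Proof.
move=> s0; set m := ex _ _.
have i1 : intg mu (fun x => x * normal_pdf 0 s x).
  by apply: intg_poly_pdf => //; exact: norm_le_quartic.
have s1 : s != 0 by rewrite gt_eqF.
have key x : (1 - m ^+ 2 / (s ^+ 2 *+ 2)) * normal_pdf 0 s x +
    m / s ^+ 2 * (x * normal_pdf 0 s x) <= normal_pdf m s x.
  rewrite !normal_pdf_pos//.
  have -> : - (x - m) ^+ 2 / (s ^+ 2 *+ 2) =
      - (x - 0) ^+ 2 / (s ^+ 2 *+ 2) + (m / s ^+ 2 * x - m ^+ 2 / (s ^+ 2 *+ 2)).
    by field.
  rewrite expRD; set u := m / s ^+ 2 * x - _.
  have := expR_ge1Dx u.
  set E := expR (- _ / _); have E0 : 0 <= E by exact: expR_ge0.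
  have := normal_peak_ge0 s; set k := normal_peak s => k0 hu.
  rewrite [leRHS]mulrA; apply: le_trans _ (ler_wpM2l (mulr_ge0 k0 E0) hu).
  by rewrite le_eqVlt; apply/orP; left; apply/eqP; rewrite /u; field.
have := ex_le (intgD (intgZ _ (intg_normal_pdf 0 s)) (intgZ _ i1))
  (intg_normal_pdf m s) key.
rewrite (exD (intgZ _ (intg_normal_pdf 0 s)) (intgZ _ i1)) (exZ _ i1).
rewrite (exZ _ (intg_normal_pdf 0 s)) !ex_normal_pdf.
rewrite -/m mulr1.
have -> : 1 - m ^+ 2 / (s ^+ 2 *+ 2) + m / s ^+ 2 * m = 1 + m ^+ 2 / (s ^+ 2 *+ 2).
  by field.
rewrite gerDl => h; apply/eqP; rewrite -sqrf_eq0 eq_le sqr_ge0 andbT.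
by rewrite -(@pmulr_lle0 _ (s ^+ 2 *+ 2)^-1) ?invr_gt0 ?pmulrn_lgt0 ?exprn_gt0// mulrC.
Qed.

(* [expR u >= 1 + u] again, now for the standard deviations [s] and [r]; letting [r]
   tend to [s] from both sides pins down the second moment. *)
Lemma normal_pdf_tangent s r x : 0 < s -> 0 < r ->
  s * (x ^+ 2 * normal_pdf 0 s x) * ((r ^+ 2 - s ^+ 2) / (2 * s ^+ 2 * r ^+ 2))
   <= r * normal_pdf 0 r x - s * normal_pdf 0 s x.
Proof.
move=> s0 r0; rewrite !normal_pdf_pos// subr0 (mulrCA (x ^+ 2)) !(mulrA s) (mulrA r).
rewrite !normal_peak_scale//; set k := normal_peak 1.
have k0 : 0 <= k by exact: normal_peak_ge0.
have s1 : s != 0 by rewrite gt_eqF.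
have r1 : r != 0 by rewrite gt_eqF.
have -> : - x ^+ 2 / (r ^+ 2 *+ 2) = - x ^+ 2 / (s ^+ 2 *+ 2) +
   x ^+ 2 * ((r ^+ 2 - s ^+ 2) / (2 * s ^+ 2 * r ^+ 2)) by field; apply/andP.
rewrite expRD; set u := x ^+ 2 * (_ / _); set E := expR (- _ / _).
have E0 : 0 <= E by exact: expR_ge0.
have := ler_wpM2l (mulr_ge0 k0 E0) (expR_ge1Dx u).
rewrite (_ : k * (x ^+ 2 * E) * _ = k * E * u); last by rewrite /u; ring.
lra.
Qed.

Lemma ex_sqr_pdf_tangent s r : 0 < s -> 0 < r ->
  s * ex mu (fun x => x ^+ 2 * normal_pdf 0 s x) *
    ((r ^+ 2 - s ^+ 2) / (2 * s ^+ 2 * r ^+ 2)) <= r - s.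
Proof.
move=> s0 r0.
have i2 : intg mu (fun x => x ^+ 2 * normal_pdf 0 s x).
  by apply: intg_poly_pdf; [|exact: measurable_funX|exact: sqr_le_quartic].
set c := (_ / _).
have ip := intg_normal_pdf (0:R).
have := ex_le (intgZ (s * c) i2) (intgB (intgZ r (ip r)) (intgZ s (ip s))).
rewrite exB ?exZ ?ex_normal_pdf//; try exact: intgZ.
rewrite !mulr1 mulrAC; apply => x.
have := normal_pdf_tangent x s0 r0; rewrite -/c; lra.
Qed.

Lemma ex_sqr_pdf s : 0 < s ->
  ex mu (fun x => x ^+ 2 * normal_pdf 0 s x) = s ^+ 2.
Proof.
move=> s0; set M := ex _ _.
have M0 : 0 <= M by apply: ex_ge0 => x; rewrite mulr_ge0 ?sqr_ge0 ?normal_pdf_ge0.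
(* The tangent inequality at [r = s (1 + h)], denominators cleared. Cancelling a small positive [h]
   bounds [M] above, a small negative one bounds it below. *)
have key h : -1 < h -> M * ((2 + h) * h) <= 2 * s ^+ 2 * (1 + h) ^+ 2 * h.
  move=> h1; have h0 : 0 < 1 + h by lra.
  have r0 : 0 < s * (1 + h) by rewrite mulr_gt0.
  have := ex_sqr_pdf_tangent s0 r0; rewrite -/M => H.
  have s1 : s != 0 by rewrite gt_eqF.
  have h1' : 1 + h != 0 by rewrite gt_eqF.
  have c0 : 0 <= 2 * s * (1 + h) ^+ 2 by rewrite !mulr_ge0 ?sqr_ge0// ltW.
  have := ler_wpM2l c0 H.
  rewrite (_ : 2 * s * _ * (s * M * _) = M * ((2 + h) * h)); last by field; apply/andP.
  by rewrite (_ : 2 * s * _ * _ = 2 * s ^+ 2 * (1 + h) ^+ 2 * h); last by ring.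
apply/eqP; rewrite eq_le; apply/andP; split; apply/ler_addgt0Pr => e e0.
- pose h := Num.min 1 (e / (3 * (1 + s ^+ 2))).
  have s2 := sqr_ge0 s.
  have h0 : 0 < h by rewrite lt_min ltr01 divr_gt0// mulr_gt0// ltr_wpDr.
  have h1 : h <= 1 by rewrite ge_min lexx.
  have he : h * (3 * (1 + s ^+ 2)) <= e.
    by rewrite -ler_pdivlMr ?mulr_gt0 ?ltr_wpDr// ge_min lexx orbT.
  have := key h; rewrite mulrA ler_pM2r// => /(_ _) H.
  have {}H : M * (2 + h) <= 2 * s ^+ 2 * (1 + h) ^+ 2 by apply: H; lra.
  nra.
- pose h := Num.min (1 / 2) (e / (3 * (1 + s ^+ 2))).
  have s2 := sqr_ge0 s.
  have h0 : 0 < h by rewrite lt_min divr_gt0 ?ltr01//= divr_gt0// mulr_gt0// ltr_wpDr.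
  have h1 : h <= 1 / 2 by rewrite ge_min lexx.
  have he : h * (3 * (1 + s ^+ 2)) <= e.
    by rewrite -ler_pdivlMr ?mulr_gt0 ?ltr_wpDr// ge_min lexx orbT.
  have H : M * (2 - h) >= 2 * s ^+ 2 * (1 - h) ^+ 2.
    have h2 : -1 < - h by lra.
    have := key (- h) h2; rewrite mulrA !mulrN lerN2 ler_pM2r//.
  nra.
Qed.

End NormalMoments.

(** * Linear forms in independent Gaussian variables *)

Section GaussianMoments.
Context d (T : measurableType d) (R : realType) (P : probability T R).
Context (X : T -> R) (v : R).
Hypothesis mX : measurable_fun setT X.
Hypothesis v0 : 0 <= v.
Hypothesis gX : centered_gaussian P X v.
Local Notation mu := (@lebesgue_measure R).

Lemma gaussian_transfer_ge0 (g : R -> R) : 0 < v -> measurable_fun setT g ->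
  (forall x, 0 <= g x) -> intg mu (fun x => g x * normal_pdf 0 (Num.sqrt v) x) ->
  intg P (g \o X) /\
  ex P (g \o X) = ex mu (fun x => g x * normal_pdf 0 (Num.sqrt v) x).
Proof.
move=> vp mg g0 ig; set s := Num.sqrt v in ig *.
have mg1 : measurable_fun setT (EFin \o g) by exact/measurable_EFinP.
have g01 x : (0 <= (EFin \o g) x)%E by rewrite lee_fin.
have E : (\int[P]_t ((g \o X) t)%:E =
    \int[mu]_x (g x * normal_pdf 0 s x)%:E)%E.
  pose xm : {mfun T >-> measurableTypeR R} :=
    HB.pack X (isMeasurableFun.Build _ _ T (measurableTypeR R) X mX).
  transitivity (\int[distribution P xm]_x (EFin \o g) x)%E.
    by rewrite ge0_integral_distribution.
  transitivity (\int[normal_prob 0 s]_x (EFin \o g) x)%E; last first.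
    by rewrite ge0_integral_normal_prob.
  apply: eq_measure_integral => A mA _; move: gX.
  by rewrite /centered_gaussian gt_eqF// => /(_ A mA).
split; last by rewrite /ex /Rintegral E.
apply/integrableP; split; first by apply/measurable_EFinP; exact: measurableT_comp.
under eq_integral do rewrite /= ger0_norm//.
rewrite [ltLHS]E; have /integrableP[_] := ig.
by under eq_integral do rewrite /= ger0_norm ?mulr_ge0 ?normal_pdf_ge0//.
Qed.

(** A signed [g] is the difference of the nonnegative functions [g + (1 + x^4)] and [1 + x^4], to
    which the nonnegative case applies. *)
Lemma gaussian_transfer (g : R -> R) : 0 < v -> measurable_fun setT g ->
  (forall x, `|g x| <= 1 + x ^+ 4) ->
  intg P (g \o X) /\
  ex P (g \o X) = ex mu (fun x => g x * normal_pdf 0 (Num.sqrt v) x).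
Proof.
move=> vp mg gx; have s0 : 0 < Num.sqrt v by rewrite sqrtr_gt0.
have mq : measurable_fun setT (fun x : R => 1 + x ^+ 4).
  by apply: measurable_funD => //; exact: measurable_funX.
have q0 (x : R) : 0 <= 1 + x ^+ 4 by rewrite addr_ge0// exprn_even_ge0.
have mq2 : measurable_fun setT (fun x : R => g x + (1 + x ^+ 4)).
  exact: measurable_funD.
have gq0 x : 0 <= g x + (1 + x ^+ 4).
  by rewrite -lerBlDr sub0r; have := gx x; rewrite ler_norml => /andP[].
have ig := intg_poly_pdf s0 mg gx.
have iq : intg mu (fun x => (1 + x ^+ 4) * normal_pdf 0 (Num.sqrt v) x).
  by apply: intg_poly_pdf => // x; rewrite (ger0_norm (q0 x)).
have igq : intg mu (fun x => (g x + (1 + x ^+ 4)) * normal_pdf 0 (Num.sqrt v) x).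
  by apply: eq_intg (intgD ig iq) => x; rewrite -mulrDl.
have [i1 e1] := gaussian_transfer_ge0 vp mq q0 iq.
have [i2 e2] := gaussian_transfer_ge0 vp mq2 gq0 igq.
split; first by apply: eq_intg (intgB i2 i1) => t /=; rewrite addrK.
transitivity (ex P (fun t => ((g (X t) + (1 + X t ^+ 4)) - (1 + X t ^+ 4)))).
  by apply: eq_ex => t /=; rewrite addrK.
rewrite (exB i2 i1) e1 e2 -exB//; apply: eq_ex => x.
by rewrite mulrDl addrK.
Qed.

(** Variance zero has to be covered because the receiver noise levels [sig2 i] may vanish. *)
Lemma degenerate_ae : v = 0 -> {ae P, forall t, X t = 0}.
Proof.
move=> vz; move: gX; rewrite /centered_gaussian vz eqxx => P1.
have m0 : measurable (X @^-1` [set 0]) by rewrite -[Y in measurable Y]setTI; exact: mX.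
exists (~` (X @^-1` [set 0])); split => //; first exact: measurableC.
by have := probability_setC P m0; rewrite P1 subee.
Qed.

Lemma degenerate_moment (g : R -> R) : v = 0 -> measurable_fun setT g -> g 0 = 0 ->
  intg P (g \o X) /\ ex P (g \o X) = 0.
Proof.
move=> vz mg gz; have aeX := degenerate_ae vz.
have ae0 : ae_eq P setT (EFin \o (g \o X)) (cst 0%E).
  by apply: filterS aeX => t /= -> _; rewrite gz.
have mgX : measurable_fun setT (EFin \o (g \o X)).
  by apply/measurable_EFinP; exact: measurableT_comp.
split; last first.
  rewrite /ex /Rintegral.
  by rewrite (@ae_eq_integral _ _ _ P setT (cst 0%E) _ measurableT mgX _ ae0)//= integral0.
apply/integrableP; split => //.
have ae1 : ae_eq P setT (abse \o (EFin \o (g \o X))) (cst 0%E).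
  by apply: filterS aeX => t /= -> _; rewrite gz normr0.
have mgX1 : measurable_fun setT (abse \o (EFin \o (g \o X))).
  exact: measurableT_comp.
by rewrite (@ae_eq_integral _ _ _ P setT (cst 0%E) _ measurableT mgX1 _ ae1)//= integral0.
Qed.

Lemma gaussian_moments :
  [/\ intg P X, intg P (fun t => X t ^+ 2) & intg P (fun t => X t ^+ 4)] /\
  [/\ ex P X = 0, ex P (fun t => X t ^+ 2) = v &
      ex P (fun t => X t ^+ 4) <= 64 * v ^+ 2].
Proof.
have m2 : measurable_fun setT (fun x : R => x ^+ 2) by exact: measurable_funX.
have m4 : measurable_fun setT (fun x : R => x ^+ 4) by exact: measurable_funX.
have m1 : measurable_fun setT (fun x : R => x) by exact: measurable_id.
move: v0; rewrite le_eqVlt => /predU1P[vz|vp].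
  have [i1 e1] := degenerate_moment (esym vz) m1 erefl.
  have [i2 e2] := degenerate_moment (esym vz) m2 (expr0n _ 2).
  have [i4 e4] := degenerate_moment (esym vz) m4 (expr0n _ 4).
  by split; split => //; rewrite -?vz// [leLHS]e4 expr0n mulr0.
have s0 : 0 < Num.sqrt v by rewrite sqrtr_gt0.
have q4 (x : R) : `|x ^+ 4| <= 1 + x ^+ 4.
  by rewrite ger0_norm ?exprn_even_ge0// lerDr.
have [i1 e1] := gaussian_transfer vp m1 (@norm_le_quartic R).
have [i2 e2] := gaussian_transfer vp m2 (@sqr_le_quartic R).
have [i4 e4] := gaussian_transfer vp m4 q4.
split; split => //.
- by rewrite [LHS]e1 ex_id_pdf.
- by rewrite [LHS]e2 ex_sqr_pdf// sqr_sqrtr.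
- rewrite [leLHS]e4.
  apply: (le_trans (ex_le (intg_quartic_pdf s0)
    (intgZ _ (intg_normal_pdf 0 (2 * Num.sqrt v)))
    (fun x => normal_pdf_quartic x s0))).
  rewrite exZ ?ex_normal_pdf ?mulr1; last exact: intg_normal_pdf.
  by rewrite (exprM _ 2 2) sqr_sqrtr.
Qed.

End GaussianMoments.

(** * Moments of Gaussian linear forms with random coefficients *)

Section QuadraticForms.
Context d (T : measurableType d) (R : realType) (P : probability T R).
Context (I : eqType) (X : I -> T -> R).
Hypothesis mX : forall i, measurable_fun setT (X i).
Hypothesis indX : mutually_independent P X.
Local Notation dep := (dep X).

Lemma depD L f g : dep L f -> dep L g -> dep L (fun t => f t + g t).
Proof. exact: measurable_funD. Qed.

Lemma depB L f g : dep L f -> dep L g -> dep L (fun t => f t - g t).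
Proof. exact: measurable_funB. Qed.

Lemma depM L f g : dep L f -> dep L g -> dep L (fun t => f t * g t).
Proof. exact: measurable_funM. Qed.

Lemma dep_cst L (c : R) : dep L (fun=> c).
Proof. exact: measurable_cst. Qed.

Lemma depX L f n : dep L f -> dep L (fun t => f t ^+ n).
Proof. exact: measurable_funX. Qed.

Lemma dep_comp L (g : R -> R) f : measurable_fun setT g -> dep L f ->
  dep L (fun t => g (f t)).
Proof. by move=> mg df; exact: (measurableT_comp mg df). Qed.

Lemma dep_sum (J : Type) (s : seq J) (p : pred J) L (F : J -> T -> R) :
  (forall j, p j -> dep L (F j)) -> dep L (fun t => \sum_(j <- s | p j) F j t).
Proof.
move=> dF; elim: s => [|j s IH].
  by rewrite (_ : (fun _ => _) = (fun=> 0)); [exact: dep_cst|apply/funext => t; rewrite big_nil].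
case: (boolP (p j)) => pj.
  rewrite (_ : (fun _ => _) = (fun t => F j t + \sum_(j <- s | p j) F j t)).
    by apply: depD => //; exact: dF.
  by apply/funext => t; rewrite big_cons pj.
rewrite (_ : (fun _ => _) = (fun t => \sum_(j <- s | p j) F j t))//.
by apply/funext => t; rewrite big_cons (negbTE pj).
Qed.

Context (L : set I) (v : I -> R) (C : I -> T -> R) (gs : set I).
Hypothesis gauss : forall l, gs l -> ~ L l /\ 0 <= v l /\ centered_gaussian P (X l) (v l).
Hypothesis dC : forall l, gs l -> dep L (C l).

(** The coefficients depend on labels in [L] only and the Gaussian labels lie outside [L]: given
    [L], this is a linear form with constant coefficients. *)
Definition linform (s : seq I) t := \sum_(l <- s) C l t * X l t.

Lemma dep_linform s : [set` s] `<=` gs -> dep (L `|` [set` s]) (linform s).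
Proof.
move=> sg; rewrite /linform; elim: s sg => [|l s IH] sg.
  rewrite (_ : (fun _ => _) = (fun=> 0)); first exact: dep_cst.
  by apply/funext => t; rewrite big_nil.
rewrite (_ : (fun _ => _) = (fun t => C l t * X l t + \sum_(l <- s) C l t * X l t)).
  have gl : gs l by apply: sg; rewrite /= inE eqxx.
  apply: depD; first apply: depM.
  - by apply: sub_dep (dC gl) => i Li; left.
  - by apply: dep_X; right; rewrite /= inE eqxx.
  - apply: sub_dep (IH _) => i.
      by move=> [Li|iS]; [left|right; rewrite /= inE iS orbT].
    by move=> iS; apply: sg; rewrite /= inE iS orbT.
by apply/funext => t; rewrite big_cons.
Qed.

Lemma linform_fresh s l : uniq (l :: s) -> [set` l :: s] `<=` gs ->
  ~ (L `|` [set` s]) l.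
Proof.
move=> /= /andP[ls _] sg [Ll|/= lls]; last by rewrite lls in ls.
by have /gauss[] : gs l by apply: sg; rewrite /= inE eqxx.
Qed.

(** Peel off one label: it is fresh for [L] and for the remaining labels, so its mean zero kills the
    cross term and its square contributes [v l]. The weight [F] makes the formula a statement about
    the conditional second moment given [L]. *)
Lemma ex_linform_sqr s F : uniq s -> [set` s] `<=` gs -> dep L F ->
  (forall l, gs l -> intg P (fun t => F t * C l t ^+ 2)) ->
  intg P (fun t => F t * linform s t ^+ 2) /\
  ex P (fun t => F t * linform s t ^+ 2) =
  \sum_(l <- s) v l * ex P (fun t => F t * C l t ^+ 2).
Proof.
move=> us sg dF iF; elim: s us sg => [|l s IH] us sg.
  have E t : F t * linform [::] t ^+ 2 = 0 by rewrite /linform big_nil expr0n mulr0.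
  rewrite big_nil -[X in ex _ _ = X](ex_cst P); split.
    by apply: eq_intg (intg_cst P 0).
  exact: eq_ex.
have sg' : [set` s] `<=` gs by move=> i iS; apply: sg; rewrite /= inE iS orbT.
have [i1 e1] := IH (andP us).2 sg'.
have gl : gs l by apply: sg; rewrite /= inE eqxx.
have [_ [vl gl']] := gauss gl.
have fl := linform_fresh us sg.
have [[iX iX2 _] [eX eX2 _]] := gaussian_moments (mX l) vl gl'.
have dL f : dep L f -> dep (L `|` [set` s]) f by apply: sub_dep => i Li; left.
have dS := dep_linform sg'.
have dc := dC gl.
have mea f : dep (L `|` [set` s]) f -> measurable_fun setT f by exact: dep_measurable.
have icross : intg P (fun t => F t * (C l t * linform s t)).
  apply: intg_dom (intgD (intg_norm (iF _ gl)) (intg_norm i1)) _.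
    by apply: mea; apply: depM; [exact: dL|apply: depM => //; exact: dL].
  move=> t; rewrite !(normrM (F t)) (normrM (C l t)) -mulrDr ler_wpM2l// !normrX.
  have := sqr_ge0 (`|C l t| - `|linform s t|).
  by have := normr_ge0 (C l t); have := normr_ge0 (linform s t); nra.
have [j1 f1] := indep_mul mX indX fl (dL _ (depM dF (depX 2 dc)))
  (measurable_funX 2 (@measurable_id _ R setT)) (iF _ gl) iX2.
have dcr : dep (L `|` [set` s]) (fun t => F t * (C l t * linform s t)).
  by apply: depM; [exact: dL|apply: depM => //; exact: dL].
have [j2 f2] := indep_mul mX indX fl dcr (@measurable_id _ R setT) icross iX.
have E t : F t * linform (l :: s) t ^+ 2 =
    F t * C l t ^+ 2 * X l t ^+ 2 + (2 * (F t * (C l t * linform s t) * X l t) +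
    F t * linform s t ^+ 2).
  by rewrite /linform big_cons -/(linform s t); ring.
split.
  apply: eq_intg (intgD j1 (intgD (intgZ 2 j2) i1)) => t; exact/esym/E.
rewrite (eq_ex _ E) exD//; last by apply: intgD => //; exact: intgZ.
rewrite exD//; last exact: intgZ.
rewrite exZ// f1 f2 e1 eX2 eX mulr0 mulr0 add0r big_cons.
by congr (_ + _); rewrite mulrC.
Qed.

(** Nothing is expanded: [(a + b)^4 <= 8 (a^4 + b^4)] is applied once per label, whence the power of
    8. *)
Lemma ex_linform_quartic s : uniq s -> [set` s] `<=` gs ->
  (forall l, gs l -> intg P (fun t => C l t ^+ 4)) ->
  intg P (fun t => linform s t ^+ 4) /\
  ex P (fun t => linform s t ^+ 4) <=
    8 ^+ size s * \sum_(l <- s) 64 * v l ^+ 2 * ex P (fun t => C l t ^+ 4).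
Proof.
move=> us sg iC; elim: s us sg => [|l s IH] us sg.
  have E t : linform [::] t ^+ 4 = 0 by rewrite /linform big_nil expr0n.
  split; first by apply: eq_intg (intg_cst P 0).
  by rewrite (eq_ex _ E) ex_cst big_nil mulr0.
have sg' : [set` s] `<=` gs by move=> i iS; apply: sg; rewrite /= inE iS orbT.
have [i1 e1] := IH (andP us).2 sg'.
have gl : gs l by apply: sg; rewrite /= inE eqxx.
have [Ll [vl gl']] := gauss gl.
have [[_ _ iX4] [_ _ eX4]] := gaussian_moments (mX l) vl gl'.
have [j1 f1] := indep_mul mX indX Ll (depX 4 (dC gl))
  (measurable_funX 4 (@measurable_id _ R setT)) (iC _ gl) iX4.
have le4 (a b : R) : (a + b) ^+ 4 <= 8 * (a ^+ 4 + b ^+ 4).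
  have h1 : (a + b) ^+ 2 <= 2 * (a ^+ 2 + b ^+ 2) by have := sqr_ge0 (a - b); nra.
  have h2 : (a ^+ 2 + b ^+ 2) ^+ 2 <= 2 * (a ^+ 4 + b ^+ 4).
    by have := sqr_ge0 (a ^+ 2 - b ^+ 2); nra.
  have h3 : ((a + b) ^+ 2) ^+ 2 <= (2 * (a ^+ 2 + b ^+ 2)) ^+ 2.
    by rewrite ler_sqr ?nnegrE ?sqr_ge0// mulr_ge0// addr_ge0 ?sqr_ge0.
  by rewrite (exprM _ 2 2); lra.
have ib := intgZ 8 (intgD j1 i1).
have dom t : linform (l :: s) t ^+ 4 <= 8 * (C l t ^+ 4 * X l t ^+ 4 + linform s t ^+ 4).
  by rewrite /linform big_cons -/(linform s t) -exprMn; exact: le4.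
have mL : measurable_fun setT (linform (l :: s)) by exact: dep_measurable (dep_linform sg).
have iL : intg P (fun t => linform (l :: s) t ^+ 4).
  apply: intg_dom ib _; first exact: measurable_funX.
  by move=> t; rewrite ger0_norm ?exprn_even_ge0//; exact: dom.
split => //; apply: le_trans (ex_le iL ib dom) _.
rewrite exZ; last exact: intgD.
rewrite exD// f1 big_cons /= exprS -mulrA ler_pM2l// mulrDr lerD//.
have c0 : 0 <= ex P (fun t => C l t ^+ 4) by apply: ex_ge0 => t; rewrite exprn_even_ge0.
apply: (@le_trans _ _ (64 * v l ^+ 2 * ex P (fun t => C l t ^+ 4))).
  by rewrite mulrC ler_wpM2r.
rewrite ler_peMl ?mulr_ge0 ?sqr_ge0//.
by rewrite exprn_ege1// ler1n.
Qed.

End QuadraticForms.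

(** * Deterministic consensus *)

Section RealSequences.
Context (R : realType).
Implicit Types u a q : nat -> R.

(* Bounded partial sums: summability when [0 <= u]. *)
Definition summable_ge0 u := exists C, forall n, \sum_(0 <= l < n) u l <= C.

Lemma sum_nat_sub u m n : (m <= n)%N ->
  \sum_(m <= l < n) u l = \sum_(0 <= l < n) u l - \sum_(0 <= l < m) u l.
Proof. by move=> mn; rewrite (big_cat_nat (n := m) (leq0n m) mn) /= addrAC subrr add0r. Qed.

Lemma summable_tail u : (forall n, 0 <= u n) -> summable_ge0 u ->
  forall e, 0 < e -> exists K, forall m n, (K <= m)%N -> \sum_(m <= l < n) u l <= e.
Proof.
move=> u0 [C uC] e e0; pose S := range (fun n => \sum_(0 <= l < n) u l).
have hS : has_sup S.
  by split; [exists (\sum_(0 <= l < 0) u l); exists 0%N|exists C => _ [n _ <-]].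
have [_ [K _ <-] Ks] := sup_adherent e0 hS.
exists K => m n Km; have [mn|nm] := leqP m n; last first.
  by rewrite big_geq ?ltW// ltnW.
rewrite sum_nat_sub//; have h1 : \sum_(0 <= l < n) u l <= sup S.
  by apply: ub_le_sup; [case: hS|exists n].
have h2 : \sum_(0 <= l < K) u l <= \sum_(0 <= l < m) u l.
  rewrite (big_cat_nat (n := K) (leq0n K) Km) /= lerDl.
  by apply: sumr_ge0 => i _; exact: u0.
lra.
Qed.

Lemma cauchy_cvgn u :
  (forall e, 0 < e -> exists K, forall m, `|u (K + m)%N - u K| < e) -> cvgn u.
Proof.
move=> h; apply/cauchy_cvgP/cauchy_exP => e e0.
have [K hK] := h e e0; exists (u K); exists K => //= n /= Kn.
by rewrite /ball /= distrC -(subnKC Kn).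
Qed.

Lemma summable_is_cvgn u : (forall n, 0 <= u n) -> summable_ge0 u ->
  cvgn (fun n => \sum_(0 <= l < n) u l).
Proof.
move=> u0 us; apply: cauchy_cvgn => e e0.
have e20 : 0 < e / 2 by rewrite divr_gt0.
have [K hK] := summable_tail u0 us e20; exists K => m.
rewrite -sum_nat_sub ?leq_addr// ger0_norm ?sumr_ge0//.
by rewrite (le_lt_trans (hK K _ (leqnn K)))//; lra.
Qed.

Lemma cvgn_cauchy u : cvgn u -> forall e, 0 < e ->
  exists K, forall m n, (K <= m)%N -> (K <= n)%N -> `|u n - u m| < e.
Proof.
move=> cu e e0; have e20 : 0 < e / 2 by rewrite divr_gt0.
have /cvgrPdist_lt /(_ _ e20) [K _ hK] := cu.
exists K => m n Km Kn; have h1 := hK _ Km; have h2 := hK _ Kn.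
rewrite (_ : u n - u m = (limn u - u m) - (limn u - u n)); last by ring.
by rewrite (le_lt_trans (ler_normB _ _))//; move: h1 h2; rewrite /=; lra.
Qed.

(** Iterated [(a + b)^2 <= 2 a^2 + 2 b^2]; any constant depending only on the number of terms would
    serve. *)
Lemma sqr_sum_le (J : Type) (s : seq J) (a : J -> R) :
  (\sum_(j <- s) a j) ^+ 2 <= 2 ^+ size s * \sum_(j <- s) a j ^+ 2.
Proof.
elim: s => [|j s IH]; first by rewrite !big_nil expr0n mulr0.
rewrite !big_cons /= [X in _ <= X * _]exprS; set S := \sum_(_ <- _) a _ in IH *.
have p1 : 1 <= (2 : R) ^+ size s by rewrite exprn_ege1// ler1n.
have p2 : a j ^+ 2 <= 2 ^+ size s * a j ^+ 2 by rewrite ler_peMl ?sqr_ge0.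
have := sqr_ge0 (a j - S); lra.
Qed.

Lemma cvg_finsum (J : Type) (s : seq J) (f : J -> nat -> R) (l : J -> R) :
  (forall j, f j @ \oo --> l j) ->
  (fun n => \sum_(j <- s) f j n) @ \oo --> \sum_(j <- s) l j.
Proof.
move=> fl; elim: s => [|j s IH].
  rewrite big_nil (_ : (fun _ => _) = fun=> 0); first exact: cvg_cst.
  by apply/funext => n; rewrite big_nil.
rewrite big_cons (_ : (fun _ => _) = fun n => f j n + \sum_(i <- s) f i n).
  by apply: cvgD; [exact: fl|exact: IH].
by apply/funext => n; rewrite big_cons.
Qed.

(* Take the last time [m <= k] at which [q m < e]: on [(m, k)] one has
   [a q <= a q^2 / e], whose sum is small. *)
Lemma crossing_cvg0 a q (B C : R) : (forall n, 0 <= a n) -> (forall n, a n <= B) ->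
  (forall n, 0 <= q n) -> 0 <= C -> ~ summable_ge0 a ->
  summable_ge0 (fun n => a n * q n ^+ 2) ->
  (forall e, 0 < e -> exists K, forall m k, (K <= m)%N -> (m <= k)%N ->
     q k <= q m + e + C * \sum_(m <= l < k) a l * q l) ->
  q @ \oo --> 0.
Proof.
move=> a0 aB q0 C0 na sq osc.
have aq0 n : 0 <= a n * q n ^+ 2 by rewrite mulr_ge0 ?sqr_ge0.
have B0 : 0 <= B by exact: le_trans (a0 0%N) (aB 0%N).
suff key e : 0 < e -> exists K, forall k, (K <= k)%N -> q k <= e * (2 + C * (B + 1)).
  have c0 : 0 < 2 + C * (B + 1) by rewrite ltr_wpDr// mulr_ge0// addr_ge0.
  apply/cvgrPdist_le => e e0.
  have [K hK] := key (e / (2 + C * (B + 1))) (divr_gt0 e0 c0).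
  exists K => // n /= Kn; rewrite sub0r normrN ger0_norm//.
  by have := hK n Kn; rewrite divfK ?gt_eqF.
move=> e0; have ee0 : 0 < e ^+ 2 by rewrite exprn_gt0.
have [K1 hK1] := summable_tail aq0 sq ee0; have [K2 hK2] := osc e e0.
pose K := maxn K1 K2.
(* Otherwise [e^2 a <= a q^2] from [K] on, and [a] would be summable. *)
have [m0 Km0 qm0] : exists2 m0, (K <= m0)%N & q m0 < e.
  apply: contrapT => h; apply: na.
  have qe l : (K <= l)%N -> e <= q l.
    by move=> Kl; rewrite leNgt; apply/negP => ql; apply: h; exists l.
  exists (\sum_(0 <= l < K) a l + 1) => n.
  have [nK|Kn] := leqP n K.
    rewrite (big_cat_nat (n := n) (leq0n n) nK) /= -addrA lerDl addr_ge0//.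
    exact: sumr_ge0.
  rewrite (big_cat_nat (n := K) (leq0n K) (ltnW Kn)) /= lerD2l.
  rewrite -(ler_pM2l ee0) mulr1; apply: le_trans (hK1 K n (leq_maxl _ _)).
  rewrite mulr_sumr; apply: ler_sum_nat => l /andP[Kl _].
  have eq := qe l Kl; rewrite mulrC; apply: ler_wpM2l => //.
  by rewrite !expr2 ler_pM// ltW.
exists m0 => k m0k.
have [m [m0m mk qm last]] : exists m, [/\ (m0 <= m)%N, (m <= k)%N, q m < e &
    forall l, (m < l)%N -> (l <= k)%N -> e <= q l].
  elim: k m0k => [|k IH] m0k.
    by exists m0; split => // l ml l0; have := leq_ltn_trans (leq0n m0) (leq_trans ml l0).
  have [qk|qk] := ltP (q k.+1) e.
    by exists k.+1; split => // l kl lk; have := leq_trans kl lk; rewrite ltnn.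
  move: m0k; rewrite leq_eqVlt => /predU1P[m0k|m0k].
    by move: qk; rewrite -m0k leNgt qm0.
  have [m [h1 h2 h3 h4]] := IH m0k.
  exists m; split => // [|l ml]; first exact: leqW.
  by rewrite leq_eqVlt => /predU1P[->//|]; exact: h4.
have Km : (K <= m)%N by exact: leq_trans m0m.
apply: le_trans (hK2 m k (leq_trans (leq_maxr _ _) Km) mk) _.
(* The term [l = m], where [q m < e], costs at most [e B]. On the later ones [e (a q) <= a q^2],
   whose sum is at most [e^2]. *)
have S : \sum_(m <= l < k) a l * q l <= e * (B + 1).
  move: mk; rewrite leq_eqVlt => /predU1P[->|mk].
    by rewrite big_geq// mulr_ge0 ?addr_ge0// ltW.
  rewrite big_ltn// mulrDr lerD//.
    by rewrite mulrC ler_pM// ltW.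
  rewrite -(ler_pM2l e0) mulr1 -expr2.
  apply: le_trans (hK1 m.+1 k (leqW (leq_trans (leq_maxl _ _) Km))).
  rewrite mulr_sumr; apply: ler_sum_nat => l /andP[ml lk].
  rewrite mulrCA ler_wpM2l// expr2 ler_wpM2r//; apply: last => //.
  exact: ltnW.
have := ler_wpM2l C0 S; lra.
Qed.

(** Deterministic form of the Robbins-Siegmund argument: [1 + v] grows at most by the factors
    [1 + b n <= expR (b n)], so [v] is bounded; telescoping the recursion then bounds the sums of
    [r]. *)
Lemma gronwall_summable (v b r : nat -> R) : (forall n, 0 <= v n) ->
  (forall n, 0 <= b n) -> (forall n, 0 <= r n) -> summable_ge0 b ->
  (forall n, v n.+1 <= v n + b n * (1 + v n) - r n) ->
  (exists C, forall n, v n <= C) /\ summable_ge0 r.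
Proof.
move=> v0 b0 r0 [Cb hb] rec.
have vb n : 1 + v n <= (1 + v 0%N) * expR (\sum_(0 <= l < n) b l).
  elim: n => [|n IH]; first by rewrite big_nil expR0 mulr1.
  rewrite big_nat_recr//= expRD mulrA.
  apply: (@le_trans _ _ ((1 + v n) * (1 + b n))).
    by have := rec n; have := r0 n; lra.
  apply: ler_pM => //; [by rewrite addr_ge0|by rewrite addr_ge0|exact: expR_ge1Dx].
have vC n : v n <= (1 + v 0%N) * expR Cb.
  apply: le_trans (_ : 1 + v n <= _); first by rewrite lerDr.
  by apply: le_trans (vb n) _; rewrite ler_wpM2l ?addr_ge0// ler_expR.
split; first by exists ((1 + v 0%N) * expR Cb).
set V := _ * _ in vC; have V0 : 0 <= V by rewrite mulr_ge0 ?expR_ge0 ?addr_ge0.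
exists (v 0%N + Cb * (1 + V)) => n.
have : v n + \sum_(0 <= l < n) r l <= v 0%N + (\sum_(0 <= l < n) b l) * (1 + V).
  elim: n => [|n IH]; first by rewrite !big_nil mul0r.
  rewrite !big_nat_recr//= mulrDl.
  have := rec n; have := ler_wpM2l (b0 n) (vC n); lra.
have := ler_wpM2r (addr_ge0 ler01 V0) (hb n); have := v0 n; lra.
Qed.

End RealSequences.

(** * Consensus along one trajectory with convergent cumulative noise [M] *)

Section Consensus.
Context (R : realType) (N : nat) (e : rel 'I_N).
Context (A : 'I_N -> 'I_N -> R) (a : nat -> R) (B : R).
Context (x M : nat -> 'I_N -> R).
Hypothesis e_sym : symmetric e.
Hypothesis econn : forall i j, connect e i j.
Hypothesis Asym : forall i j, A i j = A j i.
Hypothesis A0 : forall i j, 0 <= A i j.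
Hypothesis Ae : forall i j, e i j -> 0 < A i j.
Hypothesis a0 : forall n, 0 <= a n.
Hypothesis aB : forall n, a n <= B.
Hypothesis na : ~ summable_ge0 a.
Local Notation pos := (fun y : R => Num.max y 0).
Hypothesis rec : forall k i, x k.+1 i =
  x k i - a k * \sum_j A i j * (x k i - pos (x k j)) + (M k.+1 i - M k i).
Hypothesis cM : forall i, cvgn (fun k => M k i).
Hypothesis sQ : summable_ge0 (fun k =>
  a k * \sum_i \sum_j A i j * (x k i - pos (x k j)) ^+ 2).
Hypothesis sN : summable_ge0 (fun k =>
  a k * \sum_i \sum_j A i j * (pos (x k j) - x k j)).

Let q k := \sum_i \sum_j A i j * `|x k i - pos (x k j)|.
Let D := \sum_i \sum_j A i j.

Let D0 : 0 <= D. Proof. by do 2 (apply: sumr_ge0 => ? _). Qed.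
Let q0 k : 0 <= q k.
Proof. by do 2 (apply: sumr_ge0 => ? _); rewrite mulr_ge0. Qed.

Let pos_lip (y z : R) : `|pos y - pos z| <= `|y - z|.
Proof.
have := ler_norm (z - y); rewrite distrC; have := ler_norm (y - z).
have := normr_ge0 (y - z); rewrite (ler_norml (pos y - pos z)).
by case: (leP y 0); case: (leP z 0) => *; apply/andP; split; lra.
Qed.

(* Cauchy-Schwarz: [2 s |t| <= s^2 + t^2] summed with the weights [A]. *)
Let q_sqr k : q k ^+ 2 <= D * \sum_i \sum_j A i j * (x k i - pos (x k j)) ^+ 2.
Proof.
set Q := \sum_i _.
have key s : 2 * s * q k <= D * s ^+ 2 + Q.
  rewrite /q /D /Q mulr_sumr mulr_suml -big_split; apply: ler_sum => i _ /=.
  rewrite mulr_sumr mulr_suml -big_split; apply: ler_sum => j _ /=.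
  set w := x k i - _; rewrite mulrCA -mulrDr ler_wpM2l// -[w ^+ 2]real_normK ?num_real//.
  have := sqr_ge0 (s - `|w|); lra.
have [D00|Dn0] := eqVneq D 0.
  (* With [D = 0] the bound is linear in [s]; unless [q k = 0], this [s] would yield
     [Q + 1 <= Q]. *)
  have := key ((Q + 1) / 2 * (q k)^-1); rewrite D00 mul0r mul0r add0r.
  have [-> _|qn0] := eqVneq (q k) 0; first by rewrite expr0n.
  by rewrite -!mulrA mulVf//; lra.
have Dp : 0 < D by rewrite lt_def Dn0.
(* The optimal choice: [s = q k / D] minimises [D s^2 - 2 s q k]. *)
have := key (q k / D); rewrite -(ler_pM2l Dp).
rewrite (_ : D * (2 * (q k / D) * q k) = 2 * q k ^+ 2); last by field.
rewrite (_ : D * (D * (q k / D) ^+ 2 + Q) = q k ^+ 2 + D * Q); last by field.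
lra.
Qed.

Let drift_le k i : `|\sum_j A i j * (x k i - pos (x k j))| <= q k.
Proof.
apply: le_trans (ler_norm_sum _ _ _) _; rewrite /q [leRHS](bigD1 i)//= ler_wpDr//.
  by apply: sumr_ge0 => l _; apply: sumr_ge0 => j _; rewrite mulr_ge0.
by apply: ler_sum => j _; rewrite normrM (ger0_norm (A0 i j)).
Qed.

Let x_osc m k i : (m <= k)%N ->
  `|x k i - x m i| <= \sum_(m <= l < k) a l * q l + `|M k i - M m i|.
Proof.
move=> mk.
have E : x k i - x m i = - \sum_(m <= l < k) a l * \sum_j A i j * (x l i - pos (x l j))
    + (M k i - M m i).
  elim: k mk => [|k IH].
    by rewrite leqn0 => /eqP ->; rewrite big_geq// !subrr oppr0 addr0.
  rewrite leq_eqVlt => /predU1P[->|mk].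
    by rewrite big_geq// !subrr oppr0 addr0.
  rewrite big_nat_recr//= rec.
  have := IH mk; lra.
rewrite E; apply: le_trans (ler_normD _ _) _; rewrite lerD2r normrN.
apply: le_trans (ler_norm_sum _ _ _) _; apply: ler_sum => l _.
by rewrite normrM ger0_norm// ler_wpM2l// drift_le.
Qed.

Let q_lip m k (c : R) : (forall i, `|x k i - x m i| <= c) -> q k <= q m + 2 * D * c.
Proof.
move=> h; rewrite /q /D mulrAC mulr_sumr -big_split; apply: ler_sum => i _ /=.
rewrite mulr_sumr -big_split; apply: ler_sum => j _ /=.
rewrite (mulrC _ (A i j)) -mulrDr ler_wpM2l//.
have -> : x k i - pos (x k j) = (x m i - pos (x m j)) +
  ((x k i - x m i) - (pos (x k j) - pos (x m j))) by lra.
apply: le_trans (ler_normD _ _) _; rewrite lerD2l.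
apply: le_trans (ler_normB _ _) _.
have := h i; have := h j; have := pos_lip (x k j) (x m j); lra.
Qed.

Let M_osc c : 0 < c -> exists K, forall m k, (K <= m)%N -> (K <= k)%N ->
  forall i, `|M k i - M m i| <= c.
Proof.
move=> c0; have /choice [K hK] : forall i, exists K, forall m k, (K <= m)%N -> (K <= k)%N ->
    `|M k i - M m i| < c by move=> i; exact: cvgn_cauchy.
exists (\max_i K i)%N => m k Km Kk i; apply/ltW/hK.
  by apply: leq_trans Km; exact: leq_bigmax.
by apply: leq_trans Kk; exact: leq_bigmax.
Qed.

Lemma disagreement_cvg0 : q @ \oo --> 0.
Proof.
have C0 : 0 <= 2 * D by rewrite mulr_ge0.
apply: (@crossing_cvg0 _ a q B (2 * D)) => //.
  have [C hC] := sQ; exists (D * C) => n.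
  apply: le_trans (ler_wpM2l D0 (hC n)); rewrite mulr_sumr; apply: ler_sum => l _.
  by rewrite [leRHS]mulrCA ler_wpM2l// q_sqr.
(* The disagreement moves at most [2 D] times as much as the states, so this oscillation of [M]
   costs at most [c]; the [+ 1] covers [D = 0]. *)
move=> c c0; have c1 : 0 < c / (2 * D + 1) by rewrite divr_gt0// ltr_wpDl.
have [K hK] := M_osc c1; exists K => m k Km mk.
apply: le_trans (q_lip (c := \sum_(m <= l < k) a l * q l + c / (2 * D + 1)) _) _.
  move=> i; apply: le_trans (x_osc i mk) _; rewrite lerD2l; apply: hK => //.
  exact: leq_trans mk.
have hc : 2 * D * (c / (2 * D + 1)) <= c.
  rewrite mulrCA; apply: ler_piMr; first exact: ltW.
  by rewrite ler_pdivrMr ?ltr_wpDl// mul1r lerDl.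
by rewrite mulrDr; lra.
Qed.

Let edge_cvg0 i j : e i j -> (fun k => x k i - pos (x k j)) @ \oo --> 0.
Proof.
move=> eij; apply/cvgrPdist_le => c c0.
have d0 : 0 < c * A i j by rewrite mulr_gt0 ?Ae.
have /cvgrPdist_le /(_ _ d0) [K _ hK] := disagreement_cvg0.
exists K => // k /hK /=; rewrite !sub0r !normrN (ger0_norm (q0 k)) => h.
rewrite -(ler_pM2r (Ae eij)); apply: le_trans h; rewrite mulrC.
rewrite /q (bigD1 i)//= ler_wpDr//.
  by apply: sumr_ge0 => l _; apply: sumr_ge0 => ? _; rewrite mulr_ge0.
rewrite (bigD1 j)//= ler_wpDr//.
by apply: sumr_ge0 => ? _; rewrite mulr_ge0.
Qed.

(** Asymptotic agreement is an equivalence-like relation that contains the edges, and connectivity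
    chains it along a path. *)
Let pair_cvg0 i j : (fun k => x k i - x k j) @ \oo --> 0.
Proof.
pose r i j := `[< (fun k => x k i - x k j) @ \oo --> 0 >].
have rr l : r l l.
  apply/asboolP; rewrite (_ : (fun _ => _) = fun=> 0); first exact: cvg_cst.
  by apply/funext => k; rewrite subrr.
(* Both orientations of the edge are used: if one state is positive, the other one is close to it;
   if neither is, both are close to 0. *)
have re l m : e l m -> r l m.
  move=> elm; have h1 := edge_cvg0 elm.
  have h2 : (fun k => x k m - pos (x k l)) @ \oo --> 0.
    by apply: edge_cvg0; rewrite e_sym.
  apply/asboolP/cvgrPdist_le => c c0; have c20 : 0 < c / 2 by rewrite divr_gt0.
  have /cvgrPdist_le /(_ _ c20) h1' := h1; have /cvgrPdist_le /(_ _ c20) h2' := h2.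
  near=> k; have : `|0 - (x k l - pos (x k m))| <= c / 2 by near: k.
  have : `|0 - (x k m - pos (x k l))| <= c / 2 by near: k.
  rewrite !ler_norml => /andP[h3 h4] /andP[h5 h6].
  move: h3 h4 h5 h6; case: (leP (x k l) 0) => hl; case: (leP (x k m) 0) => hm;
  by move=> *; apply/andP; split; lra.
have rt l m n : r l m -> r m n -> r l n.
  move=> /asboolP h1 /asboolP h2; apply/asboolP.
  rewrite (_ : (fun k => x k l - x k n) =
    (fun k => (x k l - x k m) + (x k m - x k n))); last first.
    by apply/funext => k; rewrite subrKA.
  by rewrite -[0]addr0; exact: cvgD.
apply/asboolP; rewrite -/(r i j).
have /connectP [p ep ->] := econn i j.
elim: p i ep => [|l p IH] i //= /andP[eil ep].
exact: rt (re _ _ eil) (IH _ ep).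
Unshelve. all: by end_near.
Qed.

Let sum_cvg : cvgn (fun k => \sum_i x k i).
Proof.
pose u k := a k * \sum_i \sum_j A i j * (pos (x k j) - x k j).
have u0 k : 0 <= u k.
  rewrite mulr_ge0//; do 2 (apply: sumr_ge0 => ? _); rewrite mulr_ge0// subr_ge0.
  by rewrite le_max lexx.
(* By symmetry of [A] the index of the linear term can be exchanged, which turns the total drift
   into nonnegative terms. *)
have key k : \sum_i \sum_j A i j * (pos (x k j) - x k j) =
    - \sum_i \sum_j A i j * (x k i - pos (x k j)).
  have e1 : \sum_i \sum_j A i j * x k i = \sum_i \sum_j A i j * x k j.
    by rewrite exchange_big; do 2 (apply: eq_bigr => ? _); rewrite Asym.
  have e2 (f g : 'I_N -> 'I_N -> R) : \sum_i \sum_j A i j * (f i j - g i j) =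
      \sum_i \sum_j A i j * f i j - \sum_i \sum_j A i j * g i j.
    rewrite -sumrB; apply: eq_bigr => i _; rewrite -sumrB.
    by apply: eq_bigr => j _; rewrite mulrBr.
  by rewrite (e2 (fun _ j => pos (x k j)) (fun _ j => x k j)) -e1
    (e2 (fun i _ => x k i) (fun _ j => pos (x k j))) opprB.
have E : (fun k => \sum_i x k i) = (fun k => (\sum_i x 0%N i - \sum_i M 0%N i) +
    \sum_i M k i + \sum_(0 <= l < k) u l).
  apply/funext; elim => [|k IH]; first by rewrite big_nil addr0 subrK.
  rewrite big_nat_recr//= addrA.
  have -> : \sum_i x k.+1 i = \sum_i x k i + u k + (\sum_i M k.+1 i - \sum_i M k i).
    rewrite (eq_bigr _ (fun i _ => rec k i)) big_split /= !sumrB -mulr_sumr.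
    by rewrite /u key mulrN.
  by rewrite IH; lra.
rewrite E; apply: is_cvgD; last exact: summable_is_cvgn.
apply: is_cvgD; first exact: is_cvg_cst.
apply/cvg_ex; exists (\sum_i limn (fun k => M k i)).
by apply: cvg_finsum => i; exact: cM.
Qed.

Lemma consensus_cvg : exists c : R, forall i, (fun k => x k i) @ \oo --> c.
Proof.
pose S k := \sum_i x k i.
exists (limn S * N%:R^-1) => i.
have N0 : N%:R != 0 :> R by rewrite pnatr_eq0 -lt0n (leq_ltn_trans _ (ltn_ord i)).
rewrite (_ : (fun k => x k i) = (fun k => S k * N%:R^-1 +
    (\sum_j (x k i - x k j)) * N%:R^-1)); last first.
  apply/funext => k; rewrite -mulrDl sumrB sumr_const card_ord subrKC.
  by rewrite -[x k i *+ N]mulr_natr mulfK.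
have cc : (fun _ : nat => N%:R^-1 : R) @ \oo --> (N%:R^-1 : R) by exact: cvg_cst.
have cS : S k @[k --> \oo] --> limn S by exact: sum_cvg.
have cD : (fun k => \sum_j (x k i - x k j)) @ \oo --> \sum_(j < N) (0 : R).
  by apply: cvg_finsum => j; exact: pair_cvg0.
rewrite big1// in cD.
have := cvgD (cvgM cS cc) (cvgM cD cc); rewrite mul0r addr0; exact.
Qed.

End Consensus.

(** * Almost sure convergence *)

Section AlmostSure.
Context d (T : measurableType d) (R : realType) (P : probability T R).

(** Monotone convergence: the sum of the series has finite integral, so it is finite almost
    everywhere. *)
Lemma ae_summable (f : nat -> T -> R) : (forall n, intg P (f n)) ->
  (forall n t, 0 <= f n t) -> summable_ge0 (fun n => ex P (f n)) ->
  {ae P, forall t, summable_ge0 (fun n => f n t)}.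
Proof.
move=> fi f0 [C hC]; pose G t := (\sum_(0 <= n <oo) (f n t)%:E)%E.
have mf n : measurable_fun setT (fun t => (f n t)%:E).
  by have /integrableP[] := fi n.
have f0' n t : setT t -> (0 <= (f n t)%:E)%E by rewrite lee_fin.
have G0 t : (0 <= G t)%E by apply: nneseries_ge0 => n _ _; exact: f0'.
have mG : measurable_fun setT G.
  by apply: ge0_emeasurable_sum => //= *; exact: f0'.
have iG : P.-integrable setT G.
  apply/integrableP; split => //; under eq_integral do rewrite gee0_abs//.
  rewrite integral_nneseries//; apply: (@le_lt_trans _ _ C%:E); last exact: ltry.
  apply: lime_le.
    apply: is_cvg_ereal_nneg_natsum_cond => n _ _.
    by apply: integral_ge0 => t _; exact: f0'.
  near=> n; under eq_bigr do rewrite -EFin_ex//.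
  by rewrite sumEFin lee_fin.
have := integrable_ae measurableT iG; apply: filterS => t /(_ I) Gf.
exists (fine (G t)) => n; rewrite -lee_fin fineK// -sumEFin.
by apply: nneseries_lim_ge => k _ _; exact: f0'.
Unshelve. all: by end_near.
Qed.

Context (I : eqType) (X : I -> T -> R).
Hypothesis mX : forall i, measurable_fun setT (X i).
Context (L : nat -> set I) (M : nat -> T -> R).
Hypothesis Lmono : forall k, L k `<=` L k.+1.
Hypothesis dM : forall k, dep X (L k) (M k).
Local Notation incr k := (fun t => M k.+1 t - M k t).
Hypothesis iM : forall k, intg P (fun t => incr k t ^+ 2).
(** The martingale property in weak form. Bounded test functions are enough, because the stopped
    walk is tested only while it is below its threshold. *)
Hypothesis orth : forall k f, dep X (L k) f -> (exists B : R, forall t, `|f t| <= B) ->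
  ex P (fun t => f t * incr k t) = 0.

Definition gate (e y : R) : R := ((`|y| < e)%R)%:R.

Lemma measurable_gate e : measurable_fun setT (gate e).
Proof.
rewrite (_ : gate e = \1_(`]- e, e[%classic : set R)); first exact: measurable_indic.
by apply/funext => y; rewrite indicE mem_setE in_itv /= -ltr_norml.
Qed.

(* The increments of [M] after time [k], frozen once they have reached size [e];
   the Kolmogorov maximal inequality is Chebyshev's inequality for [stopped]. *)
Fixpoint stopped (e : R) (k m : nat) (t : T) : R :=
  if m is m'.+1 then
    let y := stopped e k m' t in y + gate e y * incr (k + m')%N t
  else 0.

(** If the stopped walk never reaches size [e], then [M] stays within [e] of [M k] at all later
    times. A statement about a whole trajectory is thus reduced to events at single times. *)
Lemma stopped_run e k m t : (e <= `|stopped e k m t|) \/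
  (stopped e k m t = M (k + m)%N t - M k t /\
   forall j, (j <= m)%N -> `|M (k + j)%N t - M k t| < e).
Proof.
elim: m => [|m IH].
  have [e0|e0] := leP e 0; first by left; rewrite normr0.
  right; rewrite addn0 subrr; split => // j; rewrite leqn0 => /eqP ->.
  by rewrite addn0 subrr normr0.
rewrite /= /gate; case: IH => [h|[E h]].
  by left; rewrite ltNge h mul0r addr0.
rewrite E h// mul1r addrC subrKA addnS.
have [he|he] := leP e `|M (k + m)%N.+1 t - M k t|; first by left.
right; split => // j; rewrite leq_eqVlt => /predU1P[->|]; first by rewrite addnS.
exact: h.
Qed.

Lemma stopped_frozen e k m t : e <= `|stopped e k m t| ->
  stopped e k m.+1 t = stopped e k m t.
Proof. by move=> h /=; rewrite /gate ltNge h mul0r addr0. Qed.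

Lemma L_mono m n : (m <= n)%N -> L m `<=` L n.
Proof.
elim: n => [|n IH]; first by rewrite leqn0 => /eqP ->.
by rewrite leq_eqVlt => /predU1P[->//|/IH h] i /h; exact: Lmono.
Qed.

Lemma dep_stopped e k m : dep X (L (k + m)%N) (stopped e k m).
Proof.
elim: m => [|m IH] /=; first exact: dep_cst.
have h : dep X (L (k + m.+1)%N) (stopped e k m).
  by apply: sub_dep IH; apply: L_mono; rewrite leq_add2l.
apply: depD => //; apply: depM.
  by apply: (dep_comp (g := gate e)) h; exact: measurable_gate.
rewrite addnS; apply: depB; first exact: dM.
exact: (sub_dep (@Lmono (k + m)%N) (@dM (k + m)%N)).
Qed.

(** Pythagoras with the gate: each step adds at most the second moment of the increment, since the
    cross term has mean zero. *)
Lemma stopped_sqr e k m : intg P (fun t => stopped e k m t ^+ 2) /\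
  ex P (fun t => stopped e k m t ^+ 2) <=
    \sum_(k <= j < (k + m)%N) ex P (fun t => incr j t ^+ 2).
Proof.
elim: m => [|m [i1 e1]].
  rewrite addn0 big_geq//= (_ : (fun _ => _) = fun=> 0).
    by rewrite ex_cst; split => //; exact: intg_cst.
  by apply/funext => t; rewrite expr0n.
(* The factor of the increment in the cross term: the gate bounds it by [e] in absolute value, so
   [orth] applies. *)
pose f t := gate e (stopped e k m t) * stopped e k m t.
have fe t : `|f t| <= `|e|.
  rewrite /f /gate; case: (ltP `|stopped e k m t| e) => h; last by rewrite mul0r normr0.
  by rewrite mul1r (le_trans (ltW h))// ler_norm.
have df : dep X (L (k + m)%N) f.
  apply: depM; last exact: dep_stopped.
  exact: (dep_comp (@measurable_gate e) (@dep_stopped e k m)).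
have mincr : measurable_fun setT (incr (k + m)%N).
  by apply: measurable_funB; exact: (dep_measurable mX (@dM _)).
have ic : intg P (incr (k + m)%N) by exact: intg_sqr (iM _).
have ifi : intg P (fun t => f t * incr (k + m)%N t).
  apply: intg_dom (intgZ `|e| (intg_norm ic)) _.
    by apply: measurable_funM => //; exact: (dep_measurable mX df).
  by move=> t; rewrite normrM ler_wpM2r.
have orthf := orth df (ex_intro _ `|e| fe).
have ib := intgD (intgD i1 (intgZ 2 ifi)) (iM (k + m)%N).
have dom t : stopped e k m.+1 t ^+ 2 <=
    stopped e k m t ^+ 2 + 2 * (f t * incr (k + m)%N t) + incr (k + m)%N t ^+ 2.
  rewrite /= /f /gate; set b := (_ < _); have := sqr_ge0 (M (k + m)%N.+1 t - M (k + m)%N t).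
  case: b; rewrite /= ?mul1r ?mul0r; lra.
have is1 : intg P (fun t => stopped e k m.+1 t ^+ 2).
  apply: intg_dom ib _; last by move=> t; rewrite ger0_norm ?sqr_ge0//; exact: dom.
  by apply: measurable_funX; exact: (dep_measurable mX (@dep_stopped e k m.+1)).
split => //; apply: le_trans (ex_le is1 ib dom) _.
rewrite exD//; last by apply: intgD => //; exact: intgZ.
rewrite exD//; last exact: intgZ.
by rewrite exZ// orthf mulr0 addr0 addnS big_nat_recr ?leq_addr//= lerD2r.
Qed.

Lemma measurable_exit e k m : measurable [set t | e <= `|stopped e k m t|].
Proof.
have -> : [set t | e <= `|stopped e k m t|] =
    (fun t => `|stopped e k m t|) @^-1` `[e, +oo[.
  by apply/seteqP; split => t; rewrite /= in_itv /= andbT.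
rewrite -[Z in measurable Z]setTI.
apply: (measurableT_comp (@normr_measurable R setT)) => //.
exact: (dep_measurable mX (@dep_stopped e k m)).
Qed.

(** Freezing makes the exit events increase with [m], so the probability of their union is the limit
    of probabilities that Chebyshev bounds uniformly. *)
Lemma exit_measure_le e k (c : R) : 0 < e ->
  (forall m, \sum_(k <= j < (k + m)%N) ex P (fun t => incr j t ^+ 2) <= c) ->
  (P (\bigcup_m [set t | (e <= `|stopped e k m t|)%R]) <= (c / e ^+ 2)%:E)%E.
Proof.
move=> e0 hc; set A := fun m => [set t | e <= `|stopped e k m t|].
have mA m : measurable (A m) by exact: measurable_exit.
have ndA : nondecreasing_seq A.
  apply/nondecreasing_seqP => m; apply/subsetPset => t At.
  by rewrite /A /= -/(stopped e k m.+1 t) stopped_frozen.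
have mUA : measurable (\bigcup_m A m) by exact: bigcupT_measurable.
have cA := @nondecreasing_cvg_mu _ _ _ P A mA mUA ndA.
rewrite -(cvg_lim _ cA)//; apply: lime_le; first exact: cvgP cA.
near=> m => /=; have [i1 e1] := stopped_sqr e k m.
apply: le_trans (chebyshev_sqr e0 i1) _.
by rewrite lee_fin ler_pM2r ?invr_gt0 ?exprn_gt0// (le_trans e1).
Unshelve. all: by end_near.
Qed.

(** For a fixed tolerance, a non-Cauchy trajectory exits after every starting time [k], and the exit
    probability is controlled by the tail of the second moments. Countably many tolerances give the
    Cauchy property almost surely. *)
Lemma L2_martingale_cvg : summable_ge0 (fun k => ex P (fun t => incr k t ^+ 2)) ->
  {ae P, forall t, cvgn (fun k => M k t)}.
Proof.
move=> sM.
have key (q : nat) : {ae P, forall t, exists K, forall m, `|M (K + m)%N t - M K t| < q.+1%:R^-1}.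
  set e : R := q.+1%:R^-1; have e0 : 0 < e by rewrite invr_gt0.
  pose B k := \bigcup_m [set t | e <= `|stopped e k m t|].
  have mB k : measurable (B k).
    by apply: bigcupT_measurable => m; exact: measurable_exit.
  exists (\bigcap_k B k); split.
  - exact: bigcapT_measurable.
  - apply/eqP; rewrite -measure_le0; apply/lee_addgt0Pr => c c0; rewrite add0e.
    (* A tail below [c * e ^+ 2] leaves exactly [c] after Chebyshev's division by [e ^+ 2]. *)
    have c1 : 0 < c * e ^+ 2 by rewrite mulr_gt0// exprn_gt0.
    have [K hK] := summable_tail (fun k => ex_ge0 P (fun t => sqr_ge0 (incr k t))) sM c1.
    apply: (@le_trans _ _ (P (B K))).
      apply: le_measure; rewrite ?inE//; [exact: bigcapT_measurable|exact: bigcap_inf].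
    have := exit_measure_le e0 (fun m => hK K (K + m)%N (leqnn K)).
    by rewrite mulfK// gt_eqF// exprn_gt0.
  - move=> t /= h k _; apply: contrapT => nB; apply: h; exists k => m.
    have [hm|[_ hm]] := stopped_run e k m t; first by case: nB; exists m.
    exact: hm.
apply: filterS (ae_foralln key) => t h; apply: cauchy_cvgn => e e0.
have [K hK] := h (Num.trunc e^-1); exists K => m; apply: lt_trans (hK m) _.
rewrite invf_plt ?posrE//; exact: truncnS_gt.
Qed.

End AlmostSure.

(** * The over-the-air protocol *)

Section SquareIntegrable.
Context d (T : measurableType d) (R : realType) (P : probability T R).
Implicit Types f g : T -> R.

Definition l2 f := measurable_fun setT f /\ intg P (fun t => f t ^+ 2).

Lemma l2_cst (c : R) : l2 (fun=> c).
Proof. by split; [exact: measurable_cst|exact: intg_cst]. Qed.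

Lemma l2_mul f g : l2 f -> l2 g -> intg P (fun t => f t * g t).
Proof. by move=> [mf i] [mg j]; exact: intg_mul_sqr. Qed.

Lemma l2_intg f : l2 f -> intg P f.
Proof. by move=> [mf i]; exact: intg_sqr. Qed.

Lemma l2D f g : l2 f -> l2 g -> l2 (fun t => f t + g t).
Proof.
move=> lf lg; split; first by apply: measurable_funD; [case: lf|case: lg].
apply: eq_intg (intgD (intgD lf.2 (intgZ 2 (l2_mul lf lg))) lg.2) => t; ring.
Qed.

Lemma l2Z (c : R) f : l2 f -> l2 (fun t => c * f t).
Proof.
move=> lf; split; first by apply: measurable_funM => //; case: lf.
by apply: eq_intg (intgZ (c ^+ 2) lf.2) => t; rewrite exprMn.
Qed.

Lemma l2B f g : l2 f -> l2 g -> l2 (fun t => f t - g t).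
Proof.
move=> lf lg; have := l2D lf (l2Z (-1) lg).
by congr l2; apply/funext => t; rewrite mulN1r.
Qed.

Lemma l2_dom f g : measurable_fun setT f -> l2 g -> (forall t, `|f t| <= `|g t|) -> l2 f.
Proof.
move=> mf lg fg; split => //; apply: intg_dom lg.2 _; first exact: measurable_funX.
move=> t; rewrite ger0_norm ?sqr_ge0// -[f t ^+ 2]real_normK ?num_real//.
by rewrite -[g t ^+ 2]real_normK ?num_real// ler_sqr ?nnegrE.
Qed.

Lemma l2_sum (J : Type) (s : seq J) (F : J -> T -> R) :
  (forall j, l2 (F j)) -> l2 (fun t => \sum_(j <- s) F j t).
Proof.
move=> lF; elim: s => [|j s IH].
  by rewrite (_ : (fun _ => _) = fun=> 0); [exact: l2_cst|apply/funext => t; rewrite big_nil].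
rewrite (_ : (fun _ => _) = (fun t => F j t + \sum_(j <- s) F j t)); first exact: l2D.
by apply/funext => t; rewrite big_cons.
Qed.

End SquareIntegrable.

Lemma sqr_sqrtr_max (R : realType) (y : R) : Num.sqrt y ^+ 2 = Num.max y 0.
Proof.
by case: (leP y 0) => y0; [rewrite ler0_sqrtr// expr0n|rewrite sqr_sqrtr// ltW].
Qed.

Section Model.
Context (R : realType) (d : measure_display) (T : measurableType d)
  (P : probability T R) (N : nat) (e : rel 'I_N)
  (x0 : 'I_N -> R) (rho ur ui : R) (p : 'I_N -> R)
  (Lam : 'I_N -> 'I_N -> R) (sig2 : 'I_N -> R) (alpha : nat -> R)
  (gam : 'I_N -> nat -> T -> R) (hr hi : 'I_N -> 'I_N -> nat -> T -> R)
  (nr ni : 'I_N -> nat -> T -> R).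
Hypothesis e_sym : symmetric e.
Hypothesis e_irr : irreflexive e.
Hypothesis rho0 : 0 < rho.
Hypothesis u1 : ur ^+ 2 + ui ^+ 2 = 1.
Hypothesis p01 : forall i, 0 < p i < 1.
Hypothesis LamP : forall i j, Lam i j = Lam j i /\ 0 < Lam i j.
Hypothesis sig0 : forall i, 0 <= sig2 i.
Local Notation X := (model_family gam hr hi nr ni).
Hypothesis mX : forall l, measurable_fun setT (X l).
Hypothesis indX : mutually_independent P X.
Hypothesis gam01 : forall i k t, gam i k t = 0 \/ gam i k t = 1.
Hypothesis gamP : forall i k, P (gam i k @^-1` [set 1]) = (p i)%:E.
Hypothesis hG : forall i j k, complex_gaussian P (hr i j k) (hi i j k) (Lam i j).
Hypothesis alpha_ge0 : forall k, 0 <= alpha k.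
Hypothesis nG : forall i k, complex_gaussian P (nr i k) (ni i k) (sig2 i).

Local Notation x := (state e rho ur ui p Lam sig2 alpha x0 gam hr hi nr ni).
Local Notation A := (abar e rho p Lam).
Local Notation pos := (fun y : R => Num.max y 0).
Local Notation Y k i := (ysq e rho ur ui gam hr hi nr ni (x k) k i).

(** * Time stamps of the labels and adaptedness of the states *)

Definition label_time (l : lab N) : nat :=
  match l with
  | inl (_, k) | inr (inl (_, _, k)) | inr (inr (inl (_, _, k)))
  | inr (inr (inr (inl (_, k)))) | inr (inr (inr (inr (_, k)))) => k
  end.

Definition past (k : nat) : set (lab N) := [set l | (label_time l < k)%N].

Definition is_gam (l : lab N) := if l is inl _ then true else false.

(** The intermediate stage of step [k]: these labels determine the gains, while the channel and
    noise variables of time [k] are still fresh. *)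
Definition past_gam (k : nat) : set (lab N) :=
  [set l | (label_time l < k)%N || (is_gam l && (label_time l == k))].

Definition gaussian_labels (k : nat) : set (lab N) :=
  [set l | ~~ is_gam l && (label_time l == k)].

Lemma past_mono k : past k `<=` past k.+1.
Proof. by move=> l; exact: ltnW. Qed.

Lemma past_sub_gam k : past k `<=` past_gam k.
Proof. by move=> l h; rewrite /past_gam /=; apply/orP; left. Qed.

Lemma past_gam_sub k : past_gam k `<=` past k.+1.
Proof. by move=> l /orP[/ltnW//|/andP[_ /eqP <-]]; rewrite /past /=. Qed.

Lemma measurable_pos : measurable_fun setT (fun y : R => Num.max y 0).
Proof. by apply: measurable_maxr. Qed.

Definition gain i j k t := Gam gam i j k t * Num.sqrt (rho * x k j t).

Lemma dep_Gam i j k : dep X (past_gam k) (Gam gam i j k).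
Proof.
have h l : dep X (past_gam k) (gam l k).
  by apply: (@dep_X _ _ _ _ X _ (inl (l, k))); rewrite /past_gam /= eqxx orbT.
have h1 l : dep X (past_gam k) (fun t => 1 - gam l k t).
  by apply: depB; [exact: dep_cst|exact: h].
by apply: depD; apply: depM; [exact: h|exact: h1|exact: h|exact: h1].
Qed.

Lemma dep_gain i j k : dep X (past k) (x k j) -> dep X (past_gam k) (gain i j k).
Proof.
move=> dx; apply: depM; first exact: dep_Gam.
apply: (dep_comp (g := Num.sqrt)).
  by apply: continuous_measurable_fun; exact: sqrt_continuous.
by apply: depM; [exact: dep_cst|exact: (sub_dep (@past_sub_gam k) dx)].
Qed.

Lemma dep_now l : dep X (past (label_time l).+1) (X l).
Proof. by apply: dep_X; exact: ltnSn. Qed.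

Lemma dep_ysq k i : (forall j, dep X (past k) (x k j)) -> dep X (past k.+1) (Y k i).
Proof.
move=> dx.
have dg j : dep X (past k.+1) (gain i j k).
  exact: (sub_dep (@past_gam_sub k) (@dep_gain i j k (@dx j))).
have dhr j : dep X (past k.+1) (hr i j k) by exact: (@dep_now (inr (inl (i, j, k)))).
have dhi j : dep X (past k.+1) (hi i j k) by exact: (@dep_now (inr (inr (inl (i, j, k))))).
have dnr : dep X (past k.+1) (nr i k) by exact: (@dep_now (inr (inr (inr (inl (i, k)))))).
have dni : dep X (past k.+1) (ni i k) by exact: (@dep_now (inr (inr (inr (inr (i, k)))))).
have dc c : dep X (past k.+1) (fun=> c : R) by exact: dep_cst.
apply: depD; apply: depX; apply: depD => //; apply: dep_sum => j _; apply: depM;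
  try exact: (@dg j).
  exact: (depB (depM (@dhr j) (@dc ur)) (depM (@dhi j) (@dc ui))).
exact: (depD (depM (@dhr j) (@dc ui)) (depM (@dhi j) (@dc ur))).
Qed.

Lemma dep_state k i : dep X (past k) (x k i).
Proof.
elim: k i => [|k IH] i; first exact: dep_cst.
have dx : dep X (past k.+1) (x k i) by exact: (sub_dep (@past_mono k) (@IH i)).
apply: depD; apply: depM; [exact: dep_cst|exact: dx|exact: dep_cst|].
by apply: depB; [exact: dep_ysq|exact: dep_cst].
Qed.

Lemma measurable_state k i : measurable_fun setT (x k i).
Proof. exact: (dep_measurable mX (@dep_state k i)). Qed.

(** * Conditional means of the switches and of the received power *)

Lemma ex_gam i k (L : set (lab N)) F : ~ L (inl (i, k)) -> dep X L F -> intg P F ->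
  intg P (fun t => F t * gam i k t) /\
  ex P (fun t => F t * gam i k t) = p i * ex P F.
Proof.
move=> Ll dF iF; have mg : measurable_fun setT (gam i k) := mX (inl (i, k)).
have ig : intg P (gam i k).
  apply: intg_dom (intg_cst P 1) _ => // t.
  by case: (gam01 i k t) => ->; rewrite ?normr0 ?normr1.
have eg : ex P (gam i k) = p i.
  apply: EFin_inj; rewrite EFin_ex// -(gamP i k).
  rewrite -[in RHS](setIT (gam i k @^-1` _)) -integral_indic//; last first.
    by rewrite -[Z in measurable Z]setTI; exact: mg.
  apply: eq_integral => t _; rewrite indicE; congr EFin.
  case: (gam01 i k t) => h.
    by rewrite h memNset//= h => /esym/eqP; rewrite oner_eq0.
  by rewrite h mem_set.
have [] := indep_mul mX indX Ll dF (@measurable_id _ R setT) iF ig.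
by move=> h1 h2; split => //; rewrite [LHS]h2 mulrC -eg.
Qed.

(** The product of the two switches is integrated one label at a time: the switch of [i] joins the
    known labels, and that of [j] is still fresh because [i != j]. *)
Lemma ex_Gam i j k F : i != j -> dep X (past k) F -> intg P F ->
  intg P (fun t => F t * Gam gam i j k t) /\
  ex P (fun t => F t * Gam gam i j k t) =
    (p i * (1 - p j) + p j * (1 - p i)) * ex P F.
Proof.
move=> ij dF iF.
have np l : ~ past k (inl (l, k)) by rewrite /past /= ltnn.
have [i1 e1] := ex_gam (@np i) dF iF; have [i2 e2] := ex_gam (@np j) dF iF.
pose L := past k `|` [set inl (i, k)].
have nL : ~ L (inl (j, k)).
  by move=> [/np//|/= [/esym]]; exact/eqP.
have dL : dep X L (fun t => F t * gam i k t).
  apply: depM; first by apply: (sub_dep _ dF); exact: subsetUl.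
  by apply: (@dep_X _ _ _ _ X _ (inl (i, k))); right.
have [i3 e3] := ex_gam nL dL i1.
have E t : F t * Gam gam i j k t =
    F t * gam i k t + F t * gam j k t - 2 * (F t * gam i k t * gam j k t).
  by rewrite /Gam; ring.
split.
  apply: eq_intg (intgB (intgD i1 i2) (intgZ 2 i3)) => t; exact/esym/E.
rewrite (eq_ex _ E) exB; [|exact: intgD|exact: intgZ].
by rewrite exD// exZ// e1 e2 e3 e1; ring.
Qed.

Lemma Gam_sqr i j k t : Gam gam i j k t ^+ 2 = Gam gam i j k t.
Proof. by rewrite /Gam; case: (gam01 i k t) => ->; case: (gam01 j k t) => ->; ring. Qed.

Lemma gain_sqr i j k t :
  gain i j k t ^+ 2 = rho * (pos (x k j t) * Gam gam i j k t).
Proof.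
rewrite /gain exprMn Gam_sqr sqrtrM ?ltW// exprMn sqr_sqrtr ?ltW//.
by rewrite sqr_sqrtr_max; ring.
Qed.

Lemma ex_gain_sqr i j k F : e i j -> dep X (past k) F ->
  intg P (fun t => F t * pos (x k j t)) ->
  intg P (fun t => F t * gain i j k t ^+ 2) /\
  Lam i j * ex P (fun t => F t * gain i j k t ^+ 2) =
    A i j * ex P (fun t => F t * pos (x k j t)).
Proof.
move=> eij dF iF; have ij : i != j by apply/eqP => ij; move: eij; rewrite ij e_irr.
have dFx : dep X (past k) (fun t => F t * pos (x k j t)).
  by apply: depM => //; exact: (dep_comp measurable_pos (@dep_state k j)).
have [i1 e1] := ex_Gam ij dFx iF.
have E t : F t * gain i j k t ^+ 2 = rho * (F t * pos (x k j t) * Gam gam i j k t).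
  by rewrite gain_sqr; ring.
split; first by apply: eq_intg (intgZ rho i1) => t; exact/esym/E.
by rewrite (eq_ex _ E) exZ// e1 /abar eij; ring.
Qed.

Definition label_var (l : lab N) : R :=
  match l with
  | inl _ => 0
  | inr (inl (i, j, _)) | inr (inr (inl (i, j, _))) => Lam i j / 2
  | inr (inr (inr (inl (i, _)))) | inr (inr (inr (inr (i, _)))) => sig2 i / 2
  end.

(* Coefficient of the Gaussian label [l] in the real ([b = false]) or imaginary
   ([b = true]) part of [y_i(k)]; meaningful only for labels of agent [i] at time [k]. *)
Definition coef (b : bool) i k (l : lab N) (t : T) : R :=
  match l with
  | inr (inl (_, j, _)) => gain i j k t * (if b then ui else ur)
  | inr (inr (inl (_, j, _))) => gain i j k t * (if b then ur else - ui)
  | _ => 1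
  end.

Definition noise_label (b : bool) (i : 'I_N) (k : nat) : lab N :=
  if b then inr (inr (inr (inr (i, k)))) else inr (inr (inr (inl (i, k)))).

Definition part_labels (b : bool) i k : seq (lab N) :=
  [seq inr (inl (i, j, k)) | j <- index_enum 'I_N & e i j] ++
  [seq inr (inr (inl (i, j, k))) | j <- index_enum 'I_N & e i j] ++
  [:: noise_label b i k].

Definition ypart b i k t := linform X (coef b i k) (part_labels b i k) t.

Lemma sum_part_labels b i k (f : lab N -> R) :
  \sum_(l <- part_labels b i k) f l =
  \sum_(j < N | e i j) f (inr (inl (i, j, k))) +
  \sum_(j < N | e i j) f (inr (inr (inl (i, j, k)))) + f (noise_label b i k).
Proof. by rewrite /part_labels !big_cat !big_map !big_filter big_seq1 /= addrA. Qed.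

Lemma ysqE k i t : Y k i t = ypart false i k t ^+ 2 + ypart true i k t ^+ 2.
Proof.
rewrite /ysq /ypart /linform !sum_part_labels /= !mul1r -!big_split /=.
congr ((_ + _) ^+ 2 + (_ + _) ^+ 2); apply: eq_bigr => j _; rewrite /gain; ring.
Qed.

Lemma gaussian_labelsP k l : gaussian_labels k l ->
  ~ past_gam k l /\ 0 <= label_var l /\ centered_gaussian P (X l) (label_var l).
Proof.
rewrite /gaussian_labels /past_gam /= => /andP[ng /eqP lk].
split; first by rewrite lk ltnn (negbTE ng).
have Lam0 i j : 0 <= Lam i j / 2 by rewrite divr_ge0// ltW// (LamP i j).2.
have s0 i : 0 <= sig2 i / 2 by rewrite divr_ge0.
by move: l ng lk => [[]//|[[[i j] m]|[[[i j] m]|[[i m]|[i m]]]]] _ _ /=; split => //;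
  by [case: (hG i j m)|case: (nG i m)].
Qed.

Lemma part_labels_gaussian b i k : [set` part_labels b i k] `<=` gaussian_labels k.
Proof.
move=> l /=; rewrite !mem_cat => /orP[/mapP[j _ ->]|/orP[/mapP[j _ ->]|]];
  rewrite /gaussian_labels /= ?eqxx//.
by rewrite inE => /eqP ->; rewrite /noise_label; case: b; rewrite /= eqxx.
Qed.

Lemma part_labels_uniq b i k : uniq (part_labels b i k).
Proof.
rewrite !cat_uniq !map_inj_uniq ?filter_uniq ?index_enum_uniq //=; last 2 first.
- by move=> j1 j2 [].
- by move=> j1 j2 [].
rewrite orbF andbT; apply/andP; split; last first.
  by apply/mapP => -[j _]; rewrite /noise_label; case: b.
apply/hasPn => l; rewrite mem_cat => /orP[/mapP[j _ ->]|].
  by apply/mapP => -[].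
by rewrite inE => /eqP ->; apply/mapP => -[j _]; rewrite /noise_label; case: b.
Qed.

Lemma dep_coef b i k l : dep X (past_gam k) (coef b i k l).
Proof.
move: l => [?|[[[? j] ?]|[[[? j] ?]|?]]]; try exact: dep_cst;
  by apply: depM; [exact: (@dep_gain i j k (@dep_state k j))|exact: dep_cst].
Qed.

(* As [F] ranges over functions of the past, this gives the conditional mean of
   [|y_i(k)|^2 - sig2_i]; the square root turns [x_j] into its positive part. *)
Lemma ex_ysq k i F : dep X (past k) F -> intg P F ->
  (forall j, intg P (fun t => F t * pos (x k j t))) ->
  intg P (fun t => F t * Y k i t) /\
  ex P (fun t => F t * (Y k i t - sig2 i)) =
    \sum_j A i j * ex P (fun t => F t * pos (x k j t)).
Proof.
move=> dF iF iFx.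
have dF' : dep X (past_gam k) F by exact: (sub_dep (@past_sub_gam k) dF).
pose g j := ex P (fun t => F t * gain i j k t ^+ 2).
have ig j c : e i j -> intg P (fun t => F t * (gain i j k t * c) ^+ 2) /\
    ex P (fun t => F t * (gain i j k t * c) ^+ 2) = c ^+ 2 * g j.
  move=> eij; have [i1 _] := ex_gain_sqr eij dF (@iFx j).
  have E t : F t * (gain i j k t * c) ^+ 2 = c ^+ 2 * (F t * gain i j k t ^+ 2) by ring.
  split; first by apply: eq_intg (intgZ (c ^+ 2) i1) => t; exact/esym/E.
  by rewrite (eq_ex _ E) exZ.
have iF1 : intg P (fun t => F t * 1 ^+ 2).
  by apply: eq_intg iF => t; rewrite expr1n mulr1.
have iC b l : l \in part_labels b i k -> intg P (fun t => F t * coef b i k l t ^+ 2).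
  rewrite !mem_cat => /orP[/mapP[j + ->]|/orP[/mapP[j + ->]|]].
  - by rewrite mem_filter => /andP[eij _]; have [] := ig j (if b then ui else ur) eij.
  - by rewrite mem_filter => /andP[eij _]; have [] := ig j (if b then ur else - ui) eij.
  - by rewrite inE => /eqP ->; rewrite /noise_label; case: (b).
have key b : intg P (fun t => F t * ypart b i k t ^+ 2) /\
    ex P (fun t => F t * ypart b i k t ^+ 2) =
    \sum_(j < N | e i j) Lam i j / 2 * g j + sig2 i / 2 * ex P F.
  have [i1 e1] := ex_linform_sqr mX indX (gs := [set` part_labels b i k])
    (fun l h => gaussian_labelsP (part_labels_gaussian h)) (fun l _ => @dep_coef b i k l)
    (part_labels_uniq b i k) (@subset_refl _ _) dF' (iC b).
  split => //; rewrite [LHS]e1 sum_part_labels -big_split /=; congr (_ + _).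
    apply: eq_bigr => j eij; have [_ E1] := ig j (if b then ui else ur) eij.
    have [_ E2] := ig j (if b then ur else - ui) eij.
    (* The real and imaginary parts of the channel have the same variance [Lam i j / 2], and the
       squares of their phase factors add up to [|u|^2 = 1]. *)
    rewrite E1 E2 -mulrDr -mulrDl; congr (_ * _).
    by rewrite -[RHS]mul1r -u1; case: (b); rewrite ?sqrrN // addrC.
  rewrite /noise_label; case: (b) => /=; congr (_ * _);
    by apply: eq_ex => t; rewrite expr1n mulr1.
have [[i1 e1] [i2 e2]] := (key false, key true).
have E t : F t * Y k i t = F t * ypart false i k t ^+ 2 + F t * ypart true i k t ^+ 2.
  by rewrite ysqE mulrDr.
have iY : intg P (fun t => F t * Y k i t).
  by apply: eq_intg (intgD i1 i2) => t; exact/esym/E.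
split => //.
have E' t : F t * (Y k i t - sig2 i) = F t * Y k i t - sig2 i * F t by ring.
rewrite (eq_ex _ E') exB//; last exact: intgZ.
rewrite exZ// (eq_ex _ E) exD// e1 e2.
have -> : \sum_j A i j * ex P (fun t => F t * pos (x k j t)) =
    \sum_(j < N | e i j) Lam i j * g j.
  rewrite [RHS]big_mkcond /=; apply: eq_bigr => j _.
  case: ifPn => eij; last by rewrite /abar (negbTE eij) mul0r.
  by have [_ ->] := ex_gain_sqr eij dF (@iFx j).
(* The noise in the two parts of y_i adds up to the [sig2 i] that the protocol subtracts. *)
rewrite addrACA -big_split /= (_ : _ + _ * _ = sig2 i * ex P F); last by field.
by rewrite addrK; apply: eq_bigr => j _; field.
Qed.

(** * Square integrability of the received power and of the states *)

Lemma sqr_u_le1 b : (if b then ui else ur) ^+ 2 <= 1 /\ (if b then ur else - ui) ^+ 2 <= 1.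
Proof.
have := sqr_ge0 ur; have := sqr_ge0 ui; move: u1.
by case: b; rewrite ?sqrrN => h1 h2 h3; split; lra.
Qed.

(** The gain grows like the square root of a state, so its fourth power is only quadratic. Hence
    second moments of the states control those of [|y_i|^2], and the moment recursion closes. *)
Lemma gain_quartic_le i j k t c : c ^+ 2 <= 1 ->
  (gain i j k t * c) ^+ 4 <= rho ^+ 2 * x k j t ^+ 2.
Proof.
move=> c1; rewrite exprMn (exprM _ 2 2) gain_sqr (exprM c 2 2).
have c4 : (c ^+ 2) ^+ 2 <= 1 by rewrite exprn_ile1 ?sqr_ge0.
apply: (@le_trans _ _ ((rho * (pos (x k j t) * Gam gam i j k t)) ^+ 2)).
  by rewrite ler_piMr ?sqr_ge0.
rewrite exprMn ler_wpM2l ?sqr_ge0// exprMn Gam_sqr.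
have G01 : Gam gam i j k t <= 1.
  by rewrite /Gam; case: (gam01 i k t) => ->; case: (gam01 j k t) => ->; lra.
apply: (@le_trans _ _ (pos (x k j t) ^+ 2)); first by rewrite ler_piMr ?sqr_ge0.
by case: (leP (x k j t) 0) => h //; rewrite expr0n sqr_ge0.
Qed.

Definition energy k := \sum_j ex P (fun t => x k j t ^+ 2).

Lemma ex_sqr_le_energy k j : ex P (fun t => x k j t ^+ 2) <= energy k.
Proof.
rewrite /energy (bigD1 j)//= lerDl; apply: sumr_ge0 => l _.
by apply: ex_ge0 => t; exact: sqr_ge0.
Qed.

Lemma energy_ge0 k : 0 <= energy k.
Proof. by apply: sumr_ge0 => j _; apply: ex_ge0 => t; exact: sqr_ge0. Qed.

Lemma ysq_sqr_bound i : exists2 K, 0 <= K & forall k, (forall j, l2 P (x k j)) ->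
  l2 P (Y k i) /\ ex P (fun t => Y k i t ^+ 2) <= K * (1 + energy k).
Proof.
(* Each Gaussian label contributes 64 times its squared variance; a neighbour has two labels, whence
   128. *)
pose W : R := \sum_(j < N | e i j) 128 * (Lam i j / 2) ^+ 2 * rho ^+ 2
  + 64 * (sig2 i / 2) ^+ 2.
(* The number of labels is the same for both parts and all times, so [n] keeps the constant
   independent of [k]. *)
pose n := size (part_labels false i 0).
have W0 : 0 <= W.
  apply: addr_ge0; last by rewrite mulr_ge0 ?sqr_ge0.
  by apply: sumr_ge0 => j _; rewrite mulr_ge0 ?sqr_ge0// mulr_ge0 ?sqr_ge0.
(* One factor 2 comes from [(a^2 + b^2)^2 <= 2 (a^4 + b^4)], the other from having two parts. *)
exists (4 * 8 ^+ n * W); first by rewrite mulr_ge0// mulr_ge0// exprn_ge0.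
move=> k lx; have E0 := energy_ge0 k.
have ix j := (@lx j).2.
have ig j c : c ^+ 2 <= 1 -> intg P (fun t => (gain i j k t * c) ^+ 4) /\
    ex P (fun t => (gain i j k t * c) ^+ 4) <= rho ^+ 2 * energy k.
  move=> c1; have mg : measurable_fun setT (gain i j k).
    exact: (dep_measurable mX (@dep_gain i j k (@dep_state k j))).
  have ib := intgZ (rho ^+ 2) (@ix j).
  have i1 : intg P (fun t => (gain i j k t * c) ^+ 4).
    apply: intg_dom ib _; first by apply: measurable_funX; exact: measurable_funM.
    move=> t; rewrite ger0_norm ?exprn_even_ge0//; exact: gain_quartic_le.
  split => //; apply: le_trans (ex_le i1 ib (fun t => @gain_quartic_le i j k t c c1)) _.
  by rewrite exZ// ler_wpM2l ?sqr_ge0// ex_sqr_le_energy.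
have iC b l : l \in part_labels b i k -> intg P (fun t => coef b i k l t ^+ 4).
  have [h1 h2] := sqr_u_le1 b.
  rewrite !mem_cat => /orP[/mapP[j + ->]|/orP[/mapP[j + ->]|]].
  - by move=> _; have [] := ig j _ h1.
  - by move=> _; have [] := ig j _ h2.
  - by rewrite inE => /eqP ->; rewrite /noise_label; case: (b); exact: (intg_cst P (1 ^+ 4)).
have key b : intg P (fun t => ypart b i k t ^+ 4) /\
    ex P (fun t => ypart b i k t ^+ 4) <= 8 ^+ n * (W * (1 + energy k)).
  have [i1 e1] := ex_linform_quartic mX indX (gs := [set` part_labels b i k])
    (fun l h => gaussian_labelsP (part_labels_gaussian h)) (fun l _ => @dep_coef b i k l)
    (part_labels_uniq b i k) (@subset_refl _ _) (iC b).
  split => //; apply: le_trans e1 _.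
  have -> : size (part_labels b i k) = n by rewrite /n /part_labels !size_cat !size_map.
  rewrite ler_wpM2l ?exprn_ge0// sum_part_labels -big_split /= /W [leRHS]mulrDl.
  have [h1 h2] := sqr_u_le1 b; apply: lerD.
    rewrite mulr_suml; apply: ler_sum => j _.
    have [_ E1] := ig j _ h1; have [_ E2] := ig j _ h2.
    have L0 := sqr_ge0 (Lam i j / 2).
    have := ler_wpM2l L0 E1; have := ler_wpM2l L0 E2.
    have : 0 <= (Lam i j / 2) ^+ 2 * rho ^+ 2 by rewrite mulr_ge0 ?sqr_ge0.
    set a := ex P _; set b' := ex P _; set q := (Lam i j / 2) ^+ 2; nra.
  rewrite [X in _ * X](_ : _ = 1); last first.
    rewrite -[RHS](ex_cst P); apply: eq_ex => t.
    by rewrite /noise_label; case: (b); rewrite /= expr1n.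
  rewrite (_ : label_var _ = sig2 i / 2); last by rewrite /noise_label; case: (b).
  by rewrite mulr1 ler_peMr ?mulr_ge0 ?sqr_ge0// lerDl.
have [[i1 e1] [i2 e2]] := (key false, key true).
have dom t : Y k i t ^+ 2 <= 2 * (ypart false i k t ^+ 4 + ypart true i k t ^+ 4).
  rewrite ysqE; set a := ypart _ _ _ _; set b := ypart _ _ _ _.
  by have := sqr_ge0 (a ^+ 2 - b ^+ 2); rewrite !(exprM _ 2 2); lra.
have ib := intgZ 2 (intgD i1 i2).
have mY : measurable_fun setT (Y k i).
  by apply: (dep_measurable mX); exact: (dep_ysq i (fun j => @dep_state k j)).
have iY : intg P (fun t => Y k i t ^+ 2).
  apply: intg_dom ib _; first exact: measurable_funX.
  by move=> t; rewrite ger0_norm ?sqr_ge0.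
split => //; apply: le_trans (ex_le iY ib dom) _.
rewrite exZ ?exD//; last exact: intgD.
lra.
Qed.

Lemma l2_ysq k i : (forall j, l2 P (x k j)) -> l2 P (Y k i).
Proof. by move=> lx; have [K _ /(_ k lx)[]] := ysq_sqr_bound i. Qed.

Lemma l2_state k i : l2 P (x k i).
Proof.
elim: k i => [|k IH] i; first exact: l2_cst.
apply: l2D; first exact: l2Z.
by apply: l2Z; apply: l2B; [exact: l2_ysq|exact: l2_cst].
Qed.

Lemma l2_pos k i : l2 P (fun t => pos (x k i t)).
Proof.
apply: (l2_dom _ (l2_state k i)).
  exact: (measurableT_comp measurable_pos (measurable_state k i)).
by move=> t; case: (leP (x k i t) 0) => h //; rewrite normr0.
Qed.

(** * Mean decrease of the potential *)

Lemma abar_sym i j : A i j = A j i.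
Proof. by rewrite /abar e_sym (LamP i j).1; case: ifP => // _; ring. Qed.

Lemma weight_gt0 i j : 0 < p i * (1 - p j) + p j * (1 - p i).
Proof.
have /andP[h1 h2] := p01 i; have /andP[h3 h4] := p01 j.
by rewrite addr_gt0// mulr_gt0// subr_gt0.
Qed.

Lemma abar_ge0 i j : 0 <= A i j.
Proof.
rewrite /abar; case: ifP => // _; rewrite mulr_ge0 ?ltW ?(LamP i j).2//.
by rewrite mulr_gt0// weight_gt0.
Qed.

Lemma abar_gt0 i j : e i j -> 0 < A i j.
Proof.
by move=> eij; rewrite /abar eij mulr_gt0 ?(LamP i j).2// mulr_gt0// weight_gt0.
Qed.

Definition dissipation (y : 'I_N -> R) :=
  \sum_i \sum_j A i j * (y i - pos (y j)) ^+ 2 +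
  2 * \sum_i \sum_j A i j * (pos (y j) - y j).

Lemma dissipation_part1_ge0 (y : 'I_N -> R) :
  0 <= \sum_i \sum_j A i j * (y i - pos (y j)) ^+ 2.
Proof. by do 2 (apply: sumr_ge0 => ? _); rewrite mulr_ge0 ?sqr_ge0 ?abar_ge0. Qed.

Lemma dissipation_part2_ge0 (y : 'I_N -> R) :
  0 <= \sum_i \sum_j A i j * (pos (y j) - y j).
Proof.
do 2 (apply: sumr_ge0 => ? _); rewrite mulr_ge0 ?abar_ge0//.
by rewrite subr_ge0 le_max lexx.
Qed.

(* With [z = y - 1] and [w = pos y - 1] one has [2 z_i (w_j - z_i) + (z_i - w_j)^2
   = w_j^2 - z_i^2] and [w_j^2 + 2 (pos y_j - y_j) <= z_j^2]; the symmetric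
   weights cancel what remains. *)
Lemma drift_dissipation (y : 'I_N -> R) :
  2 * \sum_i \sum_j A i j * ((y i - 1) * (pos (y j) - y i)) <= - dissipation y.
Proof.
rewrite -subr_ge0 -opprD oppr_ge0 /dissipation.
have S : \sum_i \sum_j A i j * ((y j - 1) ^+ 2 - (y i - 1) ^+ 2) = 0.
  have E : \sum_i \sum_j A i j * (y j - 1) ^+ 2 = \sum_i \sum_j A i j * (y i - 1) ^+ 2.
    by rewrite exchange_big; do 2 (apply: eq_bigr => ? _); rewrite abar_sym.
  transitivity (\sum_i \sum_j A i j * (y j - 1) ^+ 2 - \sum_i \sum_j A i j * (y i - 1) ^+ 2).
    rewrite -sumrB; apply: eq_bigr => i _; rewrite -sumrB.
    by apply: eq_bigr => j _; rewrite mulrBr.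
  by rewrite E subrr.
rewrite -[leRHS]S !mulr_sumr -!big_split; apply: ler_sum => i _ /=.
rewrite !mulr_sumr -!big_split; apply: ler_sum => j _ /=.
set a := A i j; set q := pos (y j).
have a0 : 0 <= a by exact: abar_ge0.
have h : (q - 1) ^+ 2 + 2 * (q - y j) <= (y j - 1) ^+ 2.
  by rewrite /q; case: (leP (y j) 0) => hy; have := sqr_ge0 (y j); nra.
rewrite (_ : _ + _ + _ = a * ((q - 1) ^+ 2 + 2 * (q - y j) - (y i - 1) ^+ 2)).
  by rewrite ler_wpM2l// lerD2r.
by ring.
Qed.

Definition potential k := \sum_i ex P (fun t => (x k i t - 1) ^+ 2).

Lemma l2_shift k i : l2 P (fun t => x k i t - 1).
Proof. by apply: l2B; [exact: l2_state|exact: l2_cst]. Qed.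

Lemma potential_ge0 k : 0 <= potential k.
Proof. by apply: sumr_ge0 => i _; apply: ex_ge0 => t; exact: sqr_ge0. Qed.

Lemma energy_le_potential k : energy k <= 2 * potential k + 2 * N%:R.
Proof.
rewrite /energy /potential mulr_sumr.
rewrite (_ : 2 * N%:R = \sum_(i < N) 2); last first.
  by rewrite sumr_const card_ord mulr_natr.
rewrite -big_split; apply: ler_sum => i _ /=.
have i1 := intgZ 2 (l2_shift k i).2; have i2 := intg_cst P (2 : R).
apply: le_trans (ex_le (l2_state k i).2 (intgD i1 i2) _) _.
  by move=> t; have := sqr_ge0 (x k i t - 2); lra.
by rewrite exD// exZ ?ex_cst//; case: (l2_shift k i).
Qed.

Lemma intg_dissipation k : intg P (fun t => dissipation (fun i => x k i t)).
Proof.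
apply: intgD.
  apply: intg_sum => i _; apply: intg_sum => j _; apply: intgZ.
  by apply: (l2B (l2_state k i) (l2_pos k j)).2.
apply: intgZ; apply: intg_sum => i _; apply: intg_sum => j _; apply: intgZ.
by apply: l2_intg; exact: (l2B (l2_pos k j) (l2_state k j)).
Qed.

(** The test function [x k i t - 1] in [ex_ysq] replaces the received power by its conditional mean;
    what is left under the expectation is the pathwise inequality [drift_dissipation]. *)
Lemma ex_drift_le k :
  2 * \sum_i (ex P (fun t => (x k i t - 1) * (Y k i t - sig2 i)) -
              (\sum_j A i j) * ex P (fun t => (x k i t - 1) * x k i t)) <=
  - ex P (fun t => dissipation (fun i => x k i t)).
Proof.
have i1 i j := l2_mul (l2_shift k i) (l2_pos k j).
have i2 i := l2_mul (l2_shift k i) (l2_state k i).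
have dz i : dep X (past k) (fun t => x k i t - 1).
  by apply: depB; [exact: dep_state|exact: dep_cst].
have is3 i j : intg P (fun t => A i j * ((x k i t - 1) * (pos (x k j t) - x k i t))).
  apply: intgZ; exact: (l2_mul (l2_shift k i) (l2B (l2_pos k j) (l2_state k i))).
have E : \sum_i (ex P (fun t => (x k i t - 1) * (Y k i t - sig2 i)) -
              (\sum_j A i j) * ex P (fun t => (x k i t - 1) * x k i t)) =
   ex P (fun t => \sum_i \sum_j A i j * ((x k i t - 1) * (pos (x k j t) - x k i t))).
  rewrite ex_sum; last by move=> i _; exact: intg_sum.
  apply: eq_bigr => i _; rewrite ex_sum//.
  have [_ ->] := ex_ysq i (@dz i) (l2_intg (l2_shift k i)) (i1 i).
  rewrite mulr_suml -sumrB; apply: eq_bigr => j _.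
  rewrite exZ; last exact: (l2_mul (l2_shift k i) (l2B (l2_pos k j) (l2_state k i))).
  rewrite -mulrBr -exB//; congr (_ * _); apply: eq_ex => t; by rewrite mulrBr.
rewrite E -exZ; last by apply: intg_sum => i _; exact: intg_sum.
rewrite -[leRHS]mulN1r -exZ; last exact: intg_dissipation.
apply: ex_le.
- by apply: intgZ; apply: intg_sum => i _; exact: intg_sum.
- by apply: intgZ; exact: intg_dissipation.
- by move=> t; rewrite mulN1r; exact: drift_dissipation.
Qed.

(** Expand the square of [x k i - 1] plus [alpha k] times the increment [w i]: the cross term is the
    drift, and the square of [w i] has mean of order [1 + energy k]. *)
Lemma potential_step : exists2 W, 0 <= W & forall k,
  potential k.+1 <= potential k + W * alpha k ^+ 2 * (1 + potential k) -
    alpha k * ex P (fun t => dissipation (fun i => x k i t)).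
Proof.
have /choice [K hK] : forall i, exists K, 0 <= K /\ forall k, (forall j, l2 P (x k j)) ->
    l2 P (Y k i) /\ ex P (fun t => Y k i t ^+ 2) <= K * (1 + energy k).
  by move=> i; have [K h1 h2] := ysq_sqr_bound i; exists K.
(* The 3 comes from [(a - b - c)^2 <= 3 (a^2 + b^2 + c^2)], applied to the three terms of [w i]. *)
pose C i := 3 * (K i + sig2 i ^+ 2 + (\sum_j A i j) ^+ 2).
have C0 i : 0 <= C i.
  by rewrite mulr_ge0// !addr_ge0 ?sqr_ge0//; case: (hK i).
(* The last factor passes from [1 + energy k] to [1 + potential k]. *)
exists ((\sum_i C i) * (2 + 2 * N%:R)).
  by rewrite mulr_ge0 ?sumr_ge0// addr_ge0// mulr_ge0.
move=> k; set al := alpha k.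
pose w i t := (Y k i t - sig2 i) - (\sum_j A i j) * x k i t.
have lY i := l2_ysq i (l2_state k).
have lYs i : l2 P (fun t => Y k i t - sig2 i) by apply: l2B (l2_cst _ _).
have lDx i := l2Z (\sum_j A i j) (l2_state k i).
have lw i : l2 P (w i) by exact: l2B.
have V0 := potential_ge0 k.
have ew i : ex P (fun t => w i t ^+ 2) <= C i * (2 + 2 * N%:R) * (1 + potential k).
  apply: (@le_trans _ _ (C i * (1 + energy k))); last first.
    rewrite -mulrA ler_wpM2l//; have := energy_le_potential k.
    have : 0 <= N%:R * potential k by rewrite mulr_ge0.
    lra.
  have ib := intgZ 3 (intgD (intgD (lY i).2 (l2_cst P (sig2 i)).2) (lDx i).2).
  apply: le_trans (ex_le (lw i).2 ib _) _.
    move=> t; rewrite /w; set a := Y k i t; set b := sig2 i; set c := _ * x k i t.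
    have := sqr_ge0 (a + b); have := sqr_ge0 (a + c); have := sqr_ge0 (b - c); lra.
  have iYs := intgD (lY i).2 (intg_cst P (sig2 i ^+ 2)).
  rewrite (exZ _ (intgD iYs (lDx i).2)) (exD iYs (lDx i).2).
  rewrite exD; [|exact: (lY i).2|exact: intg_cst].
  have eD : ex P (fun t => ((\sum_j A i j) * x k i t) ^+ 2) =
      (\sum_j A i j) ^+ 2 * ex P (fun t => x k i t ^+ 2).
    by rewrite -(exZ _ (l2_state k i).2); apply: eq_ex => t; rewrite exprMn.
  rewrite ex_cst eD.
  rewrite /C -mulrA ler_wpM2l//.
  have [K0 /(_ k (l2_state k)) [_ hY]] := hK i.
  have := ler_wpM2l (sqr_ge0 (\sum_j A i j)) (ex_sqr_le_energy k i).
  have := mulr_ge0 (sqr_ge0 (sig2 i)) (energy_ge0 k).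
  have := sqr_ge0 (\sum_j A i j).
  lra.
have step i : ex P (fun t => (x k.+1 i t - 1) ^+ 2) =
    ex P (fun t => (x k i t - 1) ^+ 2) + al * (2 *
    (ex P (fun t => (x k i t - 1) * (Y k i t - sig2 i)) -
     (\sum_j A i j) * ex P (fun t => (x k i t - 1) * x k i t))) +
    al ^+ 2 * ex P (fun t => w i t ^+ 2).
  have j1 := l2_mul (l2_shift k i) (lYs i).
  have j2 := l2_mul (l2_shift k i) (l2_state k i).
  rewrite -(exZ (\sum_j A i j) j2) -(exB j1 (intgZ _ j2)).
  rewrite -(exZ 2 (intgB j1 (intgZ _ j2))) -(exZ al (intgZ 2 (intgB j1 (intgZ _ j2)))).
  rewrite -(exZ (al ^+ 2) (lw i).2).
  rewrite -(exD (l2_shift k i).2 (intgZ al (intgZ 2 (intgB j1 (intgZ _ j2))))).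
  rewrite -(exD (intgD (l2_shift k i).2 (intgZ al (intgZ 2 (intgB j1 (intgZ _ j2)))))
    (intgZ (al ^+ 2) (lw i).2)).
  by apply: eq_ex => t; rewrite /= -/al /w; ring.
rewrite {1}/potential (eq_bigr _ (fun i _ => step i)) !big_split /=.
set SC := \sum_i C i; rewrite -!mulr_sumr -/(potential k).
have al0 : 0 <= alpha k by exact: alpha_ge0.
have := ler_wpM2l al0 (ex_drift_le k).
have : al ^+ 2 * \sum_i ex P (fun t => w i t ^+ 2) <=
   al ^+ 2 * ((\sum_i C i) * (2 + 2 * N%:R) * (1 + potential k)).
  by rewrite ler_wpM2l ?sqr_ge0// !mulr_suml; apply: ler_sum.
rewrite -/al -/SC; lra.
Qed.

Hypothesis alpha_sqr : summable_ge0 (fun k => alpha k ^+ 2).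

Lemma dissipation_ge0 y : 0 <= dissipation y.
Proof.
rewrite addr_ge0 ?dissipation_part1_ge0// mulr_ge0//.
exact: dissipation_part2_ge0.
Qed.

Lemma energy_summable : (exists2 B, 0 <= B & forall k, energy k <= B) /\
  summable_ge0 (fun k => ex P (fun t => alpha k * dissipation (fun i => x k i t))).
Proof.
have [W W0 step] := potential_step; have [C hC] := alpha_sqr.
have [] := @gronwall_summable _ potential (fun k => W * alpha k ^+ 2)
  (fun k => alpha k * ex P (fun t => dissipation (fun i => x k i t))) _ _ _ _ step.
- exact: potential_ge0.
- by move=> k; rewrite mulr_ge0 ?sqr_ge0.
- by move=> k; rewrite mulr_ge0 ?alpha_ge0//; apply: ex_ge0 => t; exact: dissipation_ge0.
- by exists (W * C) => n; rewrite -mulr_sumr ler_wpM2l.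
move=> [B hB] [C' hC']; split.
  exists (2 * B + 2 * N%:R).
    have := potential_ge0 0%N; have := hB 0%N; have := ler0n R N; lra.
  by move=> k; have := energy_le_potential k; have := hB k; lra.
exists C' => n; apply: le_trans (hC' n).
by apply: ler_sum => k _; rewrite exZ//; exact: intg_dissipation.
Qed.

(** * The centred received power and its weighted sums as a martingale *)

Definition noise i k t := Y k i t - sig2 i - \sum_j A i j * pos (x k j t).

Definition noise_sum i k t := \sum_(0 <= l < k) alpha l * noise i l t.

Lemma dep_noise i k : dep X (past k.+1) (noise i k).
Proof.
apply: depB.
  by apply: depB; [exact: (dep_ysq i (fun j => @dep_state k j))|exact: dep_cst].
apply: dep_sum => j _; apply: depM; first exact: dep_cst.
apply: (dep_comp measurable_pos); exact: (sub_dep (@past_mono k) (@dep_state k j)).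
Qed.

Lemma l2_gain_sum i k : l2 P (fun t => \sum_j A i j * pos (x k j t)).
Proof. by apply: l2_sum => j; apply: l2Z; exact: l2_pos. Qed.

Lemma l2_noise i k : l2 P (noise i k).
Proof.
apply: l2B (l2_gain_sum i k).
by apply: l2B (l2_cst _ _); exact: l2_ysq (l2_state k).
Qed.

Lemma noise_orth i k F : dep X (past k) F -> (exists B : R, forall t, `|F t| <= B) ->
  ex P (fun t => F t * noise i k t) = 0.
Proof.
move=> dF [B FB]; have mF := dep_measurable mX dF.
have lF : l2 P F.
  apply: l2_dom mF (l2_cst P B) _ => t.
  by rewrite (le_trans (FB t))// ler_norm.
have iFx j := l2_mul lF (l2_pos k j).
have [iY eY] := ex_ysq i dF (l2_intg lF) iFx.
have lY : l2 P (fun t => Y k i t - sig2 i).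
  by apply: l2B (l2_cst _ _); exact: l2_ysq (l2_state k).
have E t : F t * noise i k t =
    F t * (Y k i t - sig2 i) - \sum_j A i j * (F t * pos (x k j t)).
  rewrite /noise mulrBr mulr_sumr; congr (_ - _); apply: eq_bigr => j _; ring.
have iS j : intg P (fun t => A i j * (F t * pos (x k j t))) by exact: intgZ.
rewrite (eq_ex _ E) exB; [|exact: (l2_mul lF lY)|by apply: intg_sum => j _].
rewrite eY ex_sum// -sumrB big1// => j _.
by rewrite exZ// subrr.
Qed.

Lemma noise_sqr_bound i : exists2 K, 0 <= K & forall k,
  ex P (fun t => noise i k t ^+ 2) <= K * (1 + energy k).
Proof.
have [K K0 hK] := ysq_sqr_bound i.
pose m := size (index_enum 'I_N).
pose D := 2 ^+ m * \sum_j A i j ^+ 2.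
have D0 : 0 <= D by rewrite mulr_ge0 ?exprn_ge0// sumr_ge0// => j _; exact: sqr_ge0.
exists (3 * (K + sig2 i ^+ 2 + D)).
  by rewrite mulr_ge0// addr_ge0// addr_ge0// sqr_ge0.
move=> k; have [lY hY] := hK k (l2_state k).
have E0 := energy_ge0 k.
have ix := (l2_state k _).2.
have gain_le t : (\sum_j A i j * pos (x k j t)) ^+ 2 <= D * \sum_j x k j t ^+ 2.
  apply: le_trans (sqr_sum_le _ _) _; rewrite /D -mulrA ler_wpM2l ?exprn_ge0//.
  rewrite mulr_suml; apply: ler_sum => j _; rewrite exprMn ler_wpM2l ?sqr_ge0//.
  apply: (@le_trans _ _ (x k j t ^+ 2)).
    by case: (leP (x k j t) 0) => h //; rewrite expr0n sqr_ge0.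
  by rewrite (bigD1 j)//= lerDl sumr_ge0// => l _; exact: sqr_ge0.
have iS : intg P (fun t => \sum_j x k j t ^+ 2) by apply: intg_sum => j _; exact: ix.
have i1 := intgD lY.2 (l2_cst P (sig2 i)).2.
have ib := intgZ 3 (intgD i1 (intgZ D iS)).
apply: le_trans (ex_le (l2_noise i k).2 ib _) _.
  move=> t; apply: (@le_trans _ _ (3 * (Y k i t ^+ 2 + sig2 i ^+ 2 +
     (\sum_j A i j * pos (x k j t)) ^+ 2))); last first.
    by rewrite ler_pM2l// lerD2l.
  rewrite /noise; set a := Y k i t; set b := sig2 i; set c := \sum_j _.
  have := sqr_ge0 (a + b); have := sqr_ge0 (a + c); have := sqr_ge0 (b - c); lra.
rewrite exZ; last by apply: intgD => //; exact: intgZ.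
rewrite exD//; last exact: intgZ.
rewrite exD; [|exact: lY.2|exact: intg_cst].
rewrite ex_cst exZ// ex_sum; last by move=> j _; exact: ix.
rewrite -/(energy k) -[leRHS]mulrA ler_wpM2l//.
have := mulr_ge0 (sqr_ge0 (sig2 i)) E0; lra.
Qed.

Lemma noise_sum_cvg i : {ae P, forall t, cvgn (fun k => noise_sum i k t)}.
Proof.
have E k : (fun t => noise_sum i k.+1 t - noise_sum i k t) =
    (fun t => alpha k * noise i k t).
  by apply/funext => t; rewrite /noise_sum big_nat_recr//= addrAC subrr add0r.
have E2 k : (fun t => (noise_sum i k.+1 t - noise_sum i k t) ^+ 2) =
    (fun t => alpha k ^+ 2 * noise i k t ^+ 2).
  by apply/funext => t; have /(congr1 (fun f => f t)) /= -> := E k; rewrite exprMn.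
apply: (@L2_martingale_cvg _ _ _ P _ X mX past (noise_sum i)).
- exact: past_mono.
- elim=> [|k IH].
    rewrite (_ : noise_sum i 0 = fun=> 0); first exact: dep_cst.
    by apply/funext => t; rewrite /noise_sum big_nil.
  rewrite (_ : noise_sum i k.+1 = fun t => noise_sum i k t + alpha k * noise i k t).
    apply: depD; first exact: (sub_dep (@past_mono k) IH).
    by apply: depM; [exact: dep_cst|exact: dep_noise].
  by apply/funext => t; rewrite /noise_sum big_nat_recr.
- by move=> k; rewrite E2; apply: intgZ; exact: (l2_noise i k).2.
- move=> k F dF bF.
  have -> : (fun t => F t * (noise_sum i k.+1 t - noise_sum i k t)) =
      (fun t => alpha k * (F t * noise i k t)).
    by apply/funext => t; have /(congr1 (fun f => f t)) /= -> := E k; ring.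
  have lF : l2 P F.
    have [B FB] := bF; apply: l2_dom (dep_measurable mX dF) (l2_cst P B) _ => t.
    by rewrite (le_trans (FB t))// ler_norm.
  by rewrite (exZ _ (l2_mul lF (l2_noise i k))) noise_orth// mulr0.
- have [[B B0 hB] _] := energy_summable; have [K K0 hK] := noise_sqr_bound i.
  have [C hC] := alpha_sqr; exists (K * (1 + B) * C) => n.
  have KB0 : 0 <= K * (1 + B) by rewrite mulr_ge0// addr_ge0.
  apply: le_trans (ler_wpM2l KB0 (hC n)); rewrite mulr_sumr; apply: ler_sum => k _.
  rewrite E2 (exZ _ (l2_noise i k).2) mulrC ler_wpM2r ?sqr_ge0//.
  by apply: le_trans (hK k) _; rewrite ler_wpM2l// lerD2l.
Qed.

(** * From almost every trajectory to a measurable limit *)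

Hypothesis e_conn : forall i j, connect e i j.
Hypothesis alpha_sum : ~ summable_ge0 alpha.

Lemma ae_consensus : {ae P, forall t, exists c : R, forall i,
  (fun k => x k i t) @ \oo --> c}.
Proof.
have [_ sD] := energy_summable.
have aeD : {ae P, forall t, summable_ge0 (fun k => alpha k * dissipation (fun i => x k i t))}.
  apply: (@ae_summable _ _ _ P (fun k t => alpha k * dissipation (fun i => x k i t))) => //.
    by move=> k; apply: intgZ; exact: intg_dissipation.
  by move=> k t; rewrite mulr_ge0 ?alpha_ge0 ?dissipation_ge0.
have aeM : {ae P, forall t, forall i, cvgn (fun k => noise_sum i k t)}.
  (* The agents are indexed by all natural numbers, vacuously beyond [N], so that a countable
     intersection of almost sure events applies. *)
  have /ae_foralln h : forall n : nat, {ae P, forall t, forall i : 'I_N, val i = n ->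
      cvgn (fun k => noise_sum i k t)}.
    move=> n; have [nN|Nn] := ltnP n N.
      apply: filterS (noise_sum_cvg (Ordinal nN)) => t ct i iE.
      by rewrite (_ : i = Ordinal nN)//; exact: val_inj.
    by apply: filterS filterT => t _ i iE; have := ltn_ord i; rewrite iE ltnNge Nn.
  by apply: filterS h => t h i; exact: (h i i erefl).
have [B aB] : exists B, forall k, alpha k <= B.
  (* Each square is at most [C], and a real number is at most one plus its square. *)
  have [C hC] := alpha_sqr; exists (1 + C) => k.
  have h : alpha k ^+ 2 <= C.
    apply: le_trans (hC k.+1); rewrite big_nat_recr//= lerDr sumr_ge0// => l _.
    exact: sqr_ge0.
  have := sqr_ge0 (alpha k - 1); have := sqr_ge0 (alpha k); lra.
apply: filterS2 aeD aeM => t [C hC] cM.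
apply: (consensus_cvg e_sym e_conn abar_sym abar_ge0 abar_gt0 alpha_ge0 aB alpha_sum
  (x := fun k i => x k i t) (M := fun k i => noise_sum i k t)) => //.
- move=> k i; have -> : noise_sum i k.+1 t - noise_sum i k t = alpha k * noise i k t.
    by rewrite /noise_sum big_nat_recr//= addrAC subrr add0r.
  rewrite /noise.
  have -> : \sum_j A i j * (x k i t - pos (x k j t)) =
      (\sum_j A i j) * x k i t - \sum_j A i j * pos (x k j t).
    by rewrite mulr_suml -sumrB; apply: eq_bigr => j _; rewrite mulrBr.
  by rewrite /=; ring.
- exists C => n; apply: le_trans (hC n); apply: ler_sum => k _.
  by rewrite ler_wpM2l// lerDl mulr_ge0// dissipation_part2_ge0.
- exists C => n; apply: le_trans (hC n); apply: ler_sum => k _.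
  rewrite ler_wpM2l//; have := dissipation_part1_ge0 (fun i => x k i t).
  have := dissipation_part2_ge0 (fun i => x k i t); rewrite /dissipation; lra.
Qed.

Lemma as_consensus : exists xstar : T -> R, measurable_fun setT xstar /\
  forall i, {ae P, forall t, (fun k => x k i t) @ \oo --> xstar t}.
Proof.
have [i0|noi] := pselect (exists i : 'I_N, True); last first.
  (* Without agents any measurable function serves. *)
  by exists (fun=> 0); split => // i; case: noi; exists i.
case: i0 => i0 _; have [Z [mZ PZ hZ]] := ae_consensus.
(* Setting one trajectory to 0 on the measurable null set [Z] makes it converge everywhere, so its
   limit is measurable; outside [Z] all agents share this limit. *)
pose y k t := x k i0 t * \1_(~` Z) t.
have cy t : cvgn (fun k => y k t).
  have [Zt|nZt] := pselect (Z t).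
    rewrite (_ : (fun k => y k t) = fun=> 0); first exact: is_cvg_cst.
    by apply/funext => k; rewrite /y indicE memNset ?mulr0//; exact.
  have [c hc] : exists c : R, forall i, (fun k => x k i t) @ \oo --> c.
    by apply: contrapT => h; apply: nZt; exact: hZ.
  apply/cvg_ex; exists c; rewrite (_ : (fun k => y k t) = (fun k => x k i0 t))//.
  by apply/funext => k; rewrite /y indicE mem_set ?mulr1.
exists (fun t => limn (fun k => y k t)); split.
  apply: (@measurable_fun_cvg _ _ _ setT y) => [k|t _]; last exact: cy.
  by apply: measurable_funM; [exact: measurable_state|apply: measurable_indic; exact: measurableC].
move=> i; exists Z; split => // t /= h; apply: contrapT => nZt; apply: h.
have [c hc] : exists c : R, forall i, (fun k => x k i t) @ \oo --> c.
  by apply: contrapT => h; apply: nZt; exact: hZ.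
suff -> : limn (fun k => y k t) = c by exact: hc.
apply/cvg_lim => //; rewrite (_ : (fun k => y k t) = (fun k => x k i0 t))//.
by apply/funext => k; rewrite /y indicE mem_set ?mulr1.
Qed.

End Model.

Theorem theorem3 (R : realType) (d : measure_display) (T : measurableType d)
  (P : probability T R) (N : nat) (e : rel 'I_N)
  (x0 : 'I_N -> R) (xmax rho ur ui : R) (p : 'I_N -> R)
  (Lam : 'I_N -> 'I_N -> R) (sig2 : 'I_N -> R) (alpha : nat -> R)
  (gam : 'I_N -> nat -> T -> R) (hr hi : 'I_N -> 'I_N -> nat -> T -> R)
  (nr ni : 'I_N -> nat -> T -> R) :
  simple_connected_graph e ->
  (forall i, 0 <= x0 i <= xmax) ->
  0 < rho ->
  ur ^+ 2 + ui ^+ 2 = 1 ->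
  (forall i, 0 < p i < 1) ->
  (forall i j, Lam i j = Lam j i /\ 0 < Lam i j) ->
  (forall i, 0 <= sig2 i) ->
  (forall l, measurable_fun setT (model_family gam hr hi nr ni l)) ->
  mutually_independent P (model_family gam hr hi nr ni) ->
  (forall i k t, gam i k t = 0 \/ gam i k t = 1) ->
  (forall i k, P (gam i k @^-1` [set 1]) = (p i)%:E) ->
  (forall i j k, complex_gaussian P (hr i j k) (hi i j k) (Lam i j)) ->
  (forall i k, complex_gaussian P (nr i k) (ni i k) (sig2 i)) ->
  (forall k, 0 < alpha k) ->
  series alpha @ \oo --> +oo ->
  cvgn (series (fun k => alpha k ^+ 2)) ->
  (forall i k, 0 < 1 - alpha k * \sum_(j < N) abar e rho p Lam i j) ->
  exists xstar : T -> R, measurable_fun setT xstar /\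
    forall i, {ae P, forall t,
      (fun k => state e rho ur ui p Lam sig2 alpha x0 gam hr hi nr ni k i t) @ \oo
        --> xstar t}.
Proof.
move=> [e_sym [e_irr e_conn]] _ rho0 u1 p01 LamP sig0 mX indX gam01 gamP hG nG.
move=> alpha0 alpha_sum alpha_sqr _.
apply: as_consensus => //.
- by move=> k; rewrite ltW.
- exists (limn (series (fun k => alpha k ^+ 2))) => n.
  apply: nondecreasing_cvgn_le => //; apply/nondecreasing_seqP => m.
  by rewrite /series /= big_nat_recr//= lerDl sqr_ge0.
- move=> [C hC]; have /cvgryPgt /(_ C) [n _ /(_ n (leqnn n))] := alpha_sum.
  by rewrite ltNge /series /= hC.
Qed.
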